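(* Let $M^3$ be a Lagrangian submanifold of the homogeneous nearly Kähler sphere $\mathbb S^6(1)$. Then, at every point, the tensors $P$ and $A$ satisfy $$|P|^2+3\sum_{i,j,k}P_{ijk}P_{jik}\ge\tfrac9{40}|\nabla s|^2-\tfrac13|A|^2 .$$
   Context: Everything is smooth. Identify $\mathbb R^7$ with the imaginary Cayley numbers with cross product $X\times Y=\tfrac12(XY-YX)$. The homogeneous nearly Kähler structure on $\mathbb S^6(1)\subset\mathbb R^7$ is the round metric $\langle\cdot,\cdot\rangle$ with $J_xX=x\times X$. Let $\overline\nabla$ be its Levi-Civita connection and $G(X,Y)=(\overline\nabla_XJ)Y$. A Lagrangian submanifold is an immersed 3-manifold $M^3$ with the induced metric such that $J(TM)=T^\perp M$. Let $\nabla,\nabla^\perp$ be the Levi-Civita and normal connections, $h(X,Y)=\overline\nabla_XY-\nabla_XY$ the second fundamental form, and $A_\xi$ the shape operator, $\langle A_\xi X,Y\rangle=\langle h(X,Y),\xi\rangle$. It is known that $M$ is orientable and minimal and that $G(X,Y)$ is normal for tangent $X,Y$. The form $\omega(X,Y,Z)=\langle G(X,Y),JZ\rangle$ is the volume form of $M$ for a suitable orientation, which is fixed. In a local oriented orthonormal frame $\{e_1,e_2,e_3\}$: $\omega_{ijk}=\omega(e_i,e_j,e_k)$ (so $\omega_{123}=1$); $h_{ijk}=\langle h(e_i,e_j),Je_k\rangle$ (known to be totally symmetric and trace-free); $s=|h|^2=\sum_{i,j,k}h_{ijk}^2$. Set $(\nabla h)(X,Y,Z)=\nabla^\perp_Xh(Y,Z)-h(\nabla_XY,Z)-h(Y,\nabla_XZ)$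 and $$T(X,Y,Z)=(\nabla h)(X,Y,Z)-\tfrac14\{G(X,A_{JZ}Y)+G(Y,A_{JX}Z)+G(Z,A_{JY}X)\},$$ $T_{lijk}=\langle T(e_l,e_i,e_j),Je_k\rangle$ (a totally symmetric trace-free tensor). Define $$P_{ijk}=\sum_{a,b}h_{abi}T_{abjk},\quad W_{ij}=\sum_{a,b}\omega_{iab}P_{abj},\quad A_{ij}=\tfrac12(W_{ij}+W_{ji}),$$ with $|P|^2=\sum_{i,j,k} P_{ijk}^2$, $|A|^2=\sum_{i,j}A_{ij}^2$. (The matrix $A=(A_{ij})$ is not to be confused with the shape operator $A_\xi$.) *)

(* Defs.v *)
From HB Require Import structures.
From mathcomp Require Import all_boot all_order all_algebra.
From mathcomp Require Import all_classical all_reals all_analysis.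

Set Implicit Arguments.
Unset Strict Implicit.
Unset Printing Implicit Defensive.

Import Order.TTheory GRing.Theory Num.Theory numFieldNormedType.Exports.

Local Open Scope classical_set_scope.
Local Open Scope ring_scope.

Section Smooth.
Context {R : realType} {V W : normedModType R}.

Fixpoint Ck_on (n : nat) (U : set V) (f : V -> W) : Prop :=
  match n with
  | 0 => forall x, U x -> {for x, continuous f}
  | n'.+1 => (forall x, U x -> differentiable f x) /\
             forall v : V, Ck_on n' U (fun x => 'D_v f x)
  end.

Definition smooth_on (U : set V) (f : V -> W) : Prop :=
  forall n, Ck_on n U f.

End Smooth.

(** Cayley numbers, obtained from the reals by three Cayley-Dickson doublings. *)
Section Cayley.
Context {R : realType}.

Definition cd_conj {V : zmodType} (c : V -> V) (x : V * V) : V * V :=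
  (c x.1, - x.2).

Definition cd_mul {V : zmodType} (m : V -> V -> V) (c : V -> V)
    (x y : V * V) : V * V :=
  (m x.1 y.1 - m (c y.2) x.2, m y.2 x.1 + m x.2 (c y.1)).

Definition complex_conj := cd_conj (@id R).
Definition complex_mul := cd_mul (@GRing.mul R) (@id R).
Definition quaternion_conj := cd_conj complex_conj.
Definition quaternion_mul := cd_mul complex_mul complex_conj.
Definition cayley_mul := cd_mul quaternion_mul quaternion_conj.

Definition cayley : Type :=
  (((R * R) * (R * R)) * ((R * R) * (R * R)))%type.

Definition coord7 (v : 'rV[R]_7) (k : nat) : R := v 0 (inord k).

Definition cayley_of_im (v : 'rV[R]_7) : cayley :=
  (((0, coord7 v 0), (coord7 v 1, coord7 v 2)),
   ((coord7 v 3, coord7 v 4), (coord7 v 5, coord7 v 6))).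

Definition im_of_cayley (z : cayley) : 'rV[R]_7 :=
  \row_(k < 7) nth 0 [:: z.1.1.2; z.1.2.1; z.1.2.2;
                         z.2.1.1; z.2.1.2; z.2.2.1; z.2.2.2] k.

(* A commutator of Cayley numbers is imaginary, so [im_of_cayley] drops only a
   zero coordinate here. *)
Definition cross (X Y : 'rV[R]_7) : 'rV[R]_7 :=
  2^-1 *: im_of_cayley
    (cayley_mul (cayley_of_im X) (cayley_of_im Y)
     - cayley_mul (cayley_of_im Y) (cayley_of_im X)).

Definition dot (X Y : 'rV[R]_7) : R := \sum_(i < 7) X 0 i * Y 0 i.

Definition S6 : set 'rV[R]_7 := [set x | dot x x = 1].

End Cayley.

(** Smooth 3-manifolds, presented by an atlas of local parametrizations
    [cmap i : cdom i -> M] with inverses [cinv i] (both maps are total; their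
    values outside [cdom i], resp. [cimg i], are irrelevant). *)
Record atlas3 (R : realType) (M : topologicalType) := Atlas3 {
  cidx : Type ;
  cdom : cidx -> set 'rV[R]_3 ;
  cmap : cidx -> 'rV[R]_3 -> M ;
  cinv : cidx -> M -> 'rV[R]_3 ;
  cimg := fun i => cmap i @` cdom i ;
  cdom_open : forall i, open (cdom i) ;
  cimg_open : forall i, open (cimg i) ;
  cmapK : forall i x, cdom i x -> cinv i (cmap i x) = x ;
  cmap_cont : forall i, {within cdom i, continuous (cmap i)} ;
  cinv_cont : forall i, {within cimg i, continuous (cinv i)} ;
  cimg_cover : forall p, exists i, cimg i p ;
  transition_smooth : forall i j,
    smooth_on (cdom i `&` cmap i @^-1` cimg j) (cinv j \o cmap i)
}.

(** Geometry of a map [F] from an open part of R^3 into S^6.  Tangent vector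
    fields [X Y Z] of the source are given by their coordinates; vector fields
    [V] along [F] take values in R^7. *)
Section Geometry.
Context {R : realType}.
Implicit Types (F V : 'rV[R]_3 -> 'rV[R]_7) (X Y Z : 'rV[R]_3 -> 'rV[R]_3).
Implicit Types (x : 'rV[R]_3).

Definition coordf (i : 'I_3) : 'rV[R]_3 -> 'rV[R]_3 := fun=> delta_mx 0 i.

Definition push F X : 'rV[R]_3 -> 'rV[R]_7 := fun x => 'D_(X x) F x.

Definition metric F X Y x : R := dot (push F X x) (push F Y x).

Definition gram F x : 'M[R]_3 := \matrix_(i, j) metric F (coordf i) (coordf j) x.

(* The tangent vector whose inner product with each coordinate field d_i is
   [a i]. *)
Definition raise F (a : 'I_3 -> R) x : 'rV[R]_3 := (\row_i a i) *m invmx (gram F x).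

(* The almost complex structure J_x V = x cross V of S^6 along [F]. *)
Definition J F V : 'rV[R]_3 -> 'rV[R]_7 := fun x => cross (F x) (V x).

(* The Levi-Civita connection of the round sphere: the component tangent to
   S^6 of the flat derivative of R^7. *)
Definition nablaS F X V : 'rV[R]_3 -> 'rV[R]_7 := fun x =>
  let w := 'D_(X x) V x in w - dot w (F x) *: F x.

(* (nablaS_X J) V, for [V] tangent to S^6. *)
Definition nablaJ F X V : 'rV[R]_3 -> 'rV[R]_7 := fun x =>
  nablaS F X (J F V) x - J F (nablaS F X V) x.

Definition G F X Y : 'rV[R]_3 -> 'rV[R]_7 := nablaJ F X (push F Y).

(* [christoffel F i j x] has coordinates Gamma_ij^k, for the induced metric. *)
Definition christoffel F (i j : 'I_3) x : 'rV[R]_3 :=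
  raise F (fun l => 2^-1 *
    ('D_(delta_mx 0 i) (metric F (coordf j) (coordf l)) x
     + 'D_(delta_mx 0 j) (metric F (coordf i) (coordf l)) x
     - 'D_(delta_mx 0 l) (metric F (coordf i) (coordf j)) x)) x.

(* The Levi-Civita connection of the induced metric. *)
Definition nabla F X Y : 'rV[R]_3 -> 'rV[R]_3 := fun x =>
  'D_(X x) Y x
  + \sum_(i < 3) \sum_(j < 3) (X x 0 i * Y x 0 j) *: christoffel F i j x.

Definition sff F X Y : 'rV[R]_3 -> 'rV[R]_7 := fun x =>
  nablaS F X (push F Y) x - push F (nabla F X Y) x.

Definition shape F V X : 'rV[R]_3 -> 'rV[R]_3 := fun x =>
  raise F (fun j => dot (sff F X (coordf j) x) (V x)) x.

(* Component of a field along [F] that is tangent to the immersion. *)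
Definition tang F V : 'rV[R]_3 -> 'rV[R]_3 := fun x =>
  raise F (fun j => dot (V x) (push F (coordf j) x)) x.

Definition nabla_perp F X V : 'rV[R]_3 -> 'rV[R]_7 := fun x =>
  nablaS F X V x - push F (tang F (nablaS F X V)) x.

Definition nabla_sff F X Y Z : 'rV[R]_3 -> 'rV[R]_7 := fun x =>
  nabla_perp F X (sff F Y Z) x
  - sff F (nabla F X Y) Z x - sff F Y (nabla F X Z) x.

Definition Tfield F X Y Z : 'rV[R]_3 -> 'rV[R]_7 := fun x =>
  nabla_sff F X Y Z x
  - 4^-1 *: (G F X (shape F (J F (push F Z)) Y) x
             + G F Y (shape F (J F (push F X)) Z) x
             + G F Z (shape F (J F (push F Y)) X) x).

Definition omega F X Y Z x : R := dot (G F X Y x) (J F (push F Z) x).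

Definition gradient F (f : 'rV[R]_3 -> R) : 'rV[R]_3 -> 'rV[R]_3 := fun x =>
  raise F (fun i => 'D_(delta_mx 0 i) f x) x.

(* The orientation of the source is the one for which [omega] is positive. *)
Definition oriented_orthonormal_frame F (U : set 'rV[R]_3)
    (e : 'I_3 -> 'rV[R]_3 -> 'rV[R]_3) : Prop :=
  [/\ forall i, smooth_on U (e i),
      forall x i j, U x -> metric F (e i) (e j) x = (i == j)%:R &
      forall x, U x -> 0 < omega F (e 0) (e 1) (e 2) x].

Section Components.
Variables (F : 'rV[R]_3 -> 'rV[R]_7) (e : 'I_3 -> 'rV[R]_3 -> 'rV[R]_3).
Implicit Types (i j k l : 'I_3).

Definition omegac i j k x : R := omega F (e i) (e j) (e k) x.

Definition hc i j k x : R := dot (sff F (e i) (e j) x) (J F (push F (e k)) x).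

Definition sqnorm_h x : R := \sum_i \sum_j \sum_k hc i j k x ^+ 2.

Definition Tc l i j k x : R :=
  dot (Tfield F (e l) (e i) (e j) x) (J F (push F (e k)) x).

Definition Pc i j k x : R := \sum_a \sum_b hc a b i x * Tc a b j k x.

Definition Wc i j x : R := \sum_a \sum_b omegac i a b x * Pc a b j x.

Definition Ac i j x : R := 2^-1 * (Wc i j x + Wc j i x).

Definition sqnormP x : R := \sum_i \sum_j \sum_k Pc i j k x ^+ 2.

Definition sqnormA x : R := \sum_i \sum_j Ac i j x ^+ 2.

Definition sqnorm_grad_s x : R := metric F (gradient F sqnorm_h) (gradient F sqnorm_h) x.

End Components.

Definition immersion_on (U : set 'rV[R]_3) F : Prop :=
  smooth_on U F /\ forall x, U x -> injective (fun u : 'rV[R]_3 => 'D_u F x).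

Definition tangent_space F x : set 'rV[R]_7 :=
  range (fun u : 'rV[R]_3 => 'D_u F x).

(* Orthogonal complement of the tangent space inside the tangent space of
   S^6. *)
Definition normal_space F x : set 'rV[R]_7 :=
  [set xi | dot xi (F x) = 0 /\
            forall t, tangent_space F x t -> dot xi t = 0].

End Geometry.

Definition lagrangian_immersion (R : realType) (M : topologicalType)
    (atl : atlas3 R M) (f : M -> 'rV[R]_7) : Prop :=
  [/\ forall p, S6 (f p),
      forall c : cidx atl, immersion_on (cdom c) (f \o cmap c) &
      forall (c : cidx atl) x, cdom c x ->
        cross (f (cmap c x)) @` tangent_space (f \o cmap c) x
        = normal_space (f \o cmap c) x].

(* Main.v *)
Require Import Defs.
From mathcomp Require Import all_boot all_order all_algebra.
From mathcomp Require Import all_classical all_reals all_analysis.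
From HB Require Import structures.
From mathcomp Require Import ring lra.

Set Implicit Arguments.
Unset Strict Implicit.
Unset Printing Implicit Defensive.

Import Order.TTheory GRing.Theory Num.Theory numFieldNormedType.Exports.

Local Open Scope classical_set_scope.
Local Open Scope ring_scope.

(* In an adapted frame (E_i tangent, N_i = F x E_i normal) the third derivatives
   of the immersion commute; with E_i x E_j = sum_k eps_ijk N_k this gives the
   symmetries of h and the Codazzi equation, so that the corrected tensor T is
   totally symmetric and trace-free and the frame derivative of |h|^2 along e_l
   is 2 sum_i P_iil.  Hence P lies in R^3 (x) Sym^2_0(R^3), the sum of the
   SO(3)-irreducible pieces of spin 3, 2, 1, the last two being determined by A
   and by the trace sum_i P_iil.  The quadratic form |P|^2 + 3 sum P_ijk P_jik is
   4|P|^2 on the spin 3 piece, -|A|^2/3 on the spin 2 piece and 9/10 times the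
   squared trace on the spin 1 piece; the inequality drops the first. *)

(** The statement is in coordinates, through Christoffel symbols and the inverse Gram matrix, while
    the tensor algebra lives in an orthonormal frame. The bridge is the orthonormal basis F, E_i,
    N_i of R^7: all connections involved are projections of the flat derivative of R^7, whose second
    derivatives have to be commuted along the moving fields e_i. Symmetry of h is forced because
    h_ijk - h_ikj = <E_i x E_j, E_k> is alternating while h is symmetric in its first two indices;
    minimality comes from differentiating <E_0 x E_1, E_2> = 0. The weight 1/4 in T has this origin:
    since J is not parallel, nabla h exceeds the covariant derivative of the cubic form h by Q_lijk
    = sum_m h_ijm eps_lmk, and removing a quarter of each of three permuted copies of Q restores
    total symmetry. The constant 9/40 is 9/10 divided by 4, since |grad s|^2 is four times the
    squared length of the trace sum_i P_iik. *)

(** * Product rule for continuous bilinear maps *)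

Section Bilinear.
Context {R : realType} {V U1 U2 W : normedModType R}.

(** A predicate on bare functions, so that [dot], [cross] and scaling qualify directly; the bundled
    bilinear structure is packed only inside the next proof. *)
Definition continuous_bilinear (b : U1 -> U2 -> W) : Prop :=
  [/\ forall u2, linear (b ^~ u2), forall u1, linear (b u1) &
      continuous (fun p : U1 * U2 => b p.1 p.2)].

Variable b : U1 -> U2 -> W.
Hypothesis bb : continuous_bilinear b.

Lemma is_diff_bilinear (f : V -> U1) (g : V -> U2) x :
  differentiable f x -> differentiable g x ->
  is_diff x (fun y => b (f y) (g y))
    (fun v => b (f x) ('d g x v) + b ('d f x v) (g x)).
Proof.
case: bb => bl br bc df dg.
pose bM := bilinear_isBilinear.Build R U1 U2 W *:%R *:%R b (conj bl br).
pose bL : {bilinear U1 -> U2 -> W} := HB.pack b bM.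
have bcL : continuous (fun p : U1 * U2 => bL p.1 p.2) by [].
have dfg : differentiable (fun y => (f y, g y)) x by exact: differentiable_pair.
have db := differentiable_bilin (f x, g x) bcL.
apply: DiffDef; first exact: (differentiable_comp dfg db).
rewrite (_ : (fun y => b (f y) (g y)) =
  (fun p => bL p.1 p.2) \o (fun y => (f y, g y)))//.
by rewrite diff_comp// diff_bilin// diff_pair.
Qed.

Lemma differentiable_bilinear (f : V -> U1) (g : V -> U2) x :
  differentiable f x -> differentiable g x ->
  differentiable (fun y => b (f y) (g y)) x.
Proof. by move=> df dg; have [] := is_diff_bilinear df dg. Qed.

Lemma derive_bilinear (f : V -> U1) (g : V -> U2) x v :
  differentiable f x -> differentiable g x ->
  'D_v (fun y => b (f y) (g y)) x = b ('D_v f x) (g x) + b (f x) ('D_v g x).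
Proof.
move=> df dg; have [dfg e] := is_diff_bilinear df dg.
by rewrite !deriveE// e addrC.
Qed.

End Bilinear.

(** * Closure properties of C^k and smooth maps *)

Section CkClosure.
Context {R : realType} {V : normedModType R}.

(** The first-order expansion of [f] at [x] is also one of [g], since the values agree at [x] and at
    all small increments; uniqueness of the differential concludes. *)
Lemma near_eq_differentiable (W : normedModType R) (f g : V -> W) x :
  {near x, f =1 g} -> differentiable f x -> differentiable g x.
Proof.
move=> fg df; have dfE := diff_locally df.
suff H : g \o shift x = cst (g x) + 'd f x +o_ 0 id.
  by apply/diff_locallyP; rewrite (diff_unique (diff_continuous df) H); split;
    [exact: diff_continuous|].
apply/eqaddoP => _/posnumP[eps].
have /eqaddoP/(_ eps%:num (gt0 eps)) H := dfE.
rewrite -(nbhs_singleton fg).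
have fg' : \forall y \near (0 : V), f (y + x) = g (y + x).
  by rewrite (near_shift x)/=; apply: filterS fg => y; rewrite /= sub0r subrK.
by apply: filterS2 fg' H => y; rewrite /= !fctE /= => ->.
Qed.

Lemma Ck_onS (W : normedModType R) n (U : set V) (f : V -> W) :
  Ck_on n.+1 U f -> Ck_on n U f.
Proof.
elim: n f => [f [df _] x Ux|n IH f [df Df]].
  exact: differentiable_continuous (df x Ux).
by split=> // v; exact: IH (Df v).
Qed.

Lemma open_near_eq (W : Type) (U : set V) (f g : V -> W) x :
  open U -> {in U, f =1 g} -> U x -> {near x, f =1 g}.
Proof.
move=> oU fg Ux; have := open_nbhs_nbhs (conj oU Ux).
by apply: filterS => y Uy; apply: fg; rewrite inE.
Qed.

(** Openness turns equality on [U] into equality near each point, which is all that continuity and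
    derivatives see. Smoothness can thus be read off from formulas valid only on [U]. *)
Lemma Ck_on_eq (W : normedModType R) n (U : set V) (f g : V -> W) :
  open U -> {in U, f =1 g} -> Ck_on n U f -> Ck_on n U g.
Proof.
move=> oU; elim: n f g => [f g fg cf x Ux|n IH f g fg [df Df]].
  have nfg := open_near_eq oU fg Ux.
  rewrite -[{for x, _}]/(g @ x --> g x) -(nbhs_singleton nfg).
  apply: cvg_trans (cf x Ux).
  exact: near_eq_cvg.
split=> [x Ux|v].
  exact: near_eq_differentiable (open_near_eq oU fg Ux) (df x Ux).
apply: IH (Df v) => x; rewrite inE => Ux.
exact: near_eq_derive (open_near_eq oU fg Ux).
Qed.

Lemma Ck_on_cst (W : normedModType R) n (U : set V) (a : W) :
  Ck_on n U (fun=> a).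
Proof.
elim: n a => [a x _|n IH a]; first exact: cvg_cst.
split=> [x _|v]; first exact: differentiable_cst.
rewrite (_ : (fun x => 'D_v (fun=> a) x) = (fun=> 0)); first exact: IH.
by apply/funext => x; rewrite derive_cst.
Qed.

Lemma Ck_onD (W : normedModType R) n (U : set V) (f g : V -> W) :
  open U -> Ck_on n U f -> Ck_on n U g -> Ck_on n U (fun x => f x + g x).
Proof.
move=> oU; elim: n f g => [f g cf cg x Ux|n IH f g [df Df] [dg Dg]].
  exact: cvgD (cf x Ux) (cg x Ux).
split=> [x Ux|v]; first exact: differentiableD (df x Ux) (dg x Ux).
apply: Ck_on_eq (IH _ _ (Df v) (Dg v)) => // x; rewrite inE => Ux.
by rewrite [RHS]deriveD//; apply: diff_derivable; [exact: df|exact: dg].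
Qed.

(** The derivative is a sum of two terms of the same shape, with one factor differentiated and the
    other lowered by one order, so the induction closes. *)
Lemma Ck_on_bilinear (U1 U2 W : normedModType R) (b : U1 -> U2 -> W) n
    (U : set V) (f : V -> U1) (g : V -> U2) :
  open U -> continuous_bilinear b -> Ck_on n U f -> Ck_on n U g ->
  Ck_on n U (fun x => b (f x) (g x)).
Proof.
move=> oU bb; elim: n f g => [f g cf cg x Ux|n IH f g [df Df] [dg Dg]].
  have [_ _ bc] := bb.
  apply: (@continuous2_cvg _ _ _ _ (nbhs x) _ f g b (f x) (g x)).
  - exact: (bc (f x, g x)).
  - exact: cf.
  - exact: cg.
split=> [x Ux|v].
  by apply: (differentiable_bilinear bb); [exact: df|exact: dg].
have cf : Ck_on n U f by apply: Ck_onS; split.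
have cg : Ck_on n U g by apply: Ck_onS; split.
apply: (Ck_on_eq oU _ (Ck_onD oU (IH _ _ (Df v) cg) (IH _ _ cf (Dg v)))).
move=> x; rewrite inE => Ux /=.
by rewrite (derive_bilinear bb)//; [exact: df|exact: dg].
Qed.

Lemma smooth_on_derive (W : normedModType R) (U : set V) (f : V -> W) v :
  smooth_on U f -> smooth_on U ('D_v f).
Proof. by move=> sf n; have [_] := sf n.+1; apply. Qed.

Lemma smooth_on_differentiable (W : normedModType R) (U : set V) (f : V -> W) x :
  smooth_on U f -> U x -> differentiable f x.
Proof. by move=> sf; have [df _] := sf 1%N; exact: df. Qed.

Lemma smooth_on_subset (W : normedModType R) (U U' : set V) (f : V -> W) :
  U `<=` U' -> smooth_on U' f -> smooth_on U f.
Proof.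
move=> UU' sf n; elim: n f {sf}(sf n) => [f cf x /UU' /cf//|n IH f [df Df]].
by split=> [x /UU' /df//|v]; exact: IH (Df v).
Qed.

Section Smooth.
Variables (U : set V) (oU : open U).
Implicit Types W : normedModType R.

Lemma smooth_on_eq W (f g : V -> W) :
  {in U, f =1 g} -> smooth_on U f -> smooth_on U g.
Proof. by move=> fg sf n; exact: Ck_on_eq fg (sf n). Qed.

Lemma smooth_on_cst W (a : W) : smooth_on U (fun=> a).
Proof. by move=> n; exact: Ck_on_cst. Qed.

Lemma smooth_onD W (f g : V -> W) :
  smooth_on U f -> smooth_on U g -> smooth_on U (fun x => f x + g x).
Proof. by move=> sf sg n; exact: Ck_onD. Qed.

Lemma smooth_on_bilinear (U1 U2 W : normedModType R) (b : U1 -> U2 -> W)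
    (f : V -> U1) (g : V -> U2) :
  continuous_bilinear b -> smooth_on U f -> smooth_on U g ->
  smooth_on U (fun x => b (f x) (g x)).
Proof. by move=> bb sf sg n; exact: Ck_on_bilinear. Qed.

Lemma smooth_on_sum W n (f : 'I_n -> V -> W) :
  (forall i, smooth_on U (f i)) -> smooth_on U (fun x => \sum_i f i x).
Proof.
elim: n f => [|n IH] f sf.
  by apply: (smooth_on_eq _ (smooth_on_cst 0)) => x _; rewrite big_ord0.
apply: (smooth_on_eq _ (smooth_onD (sf ord0) (IH _ (fun i => sf (lift ord0 i))))).
by move=> x _; rewrite big_ord_recl.
Qed.

End Smooth.
End CkClosure.

(** * Continuity of bilinear maps in finite dimension *)

Section FiniteDimension.
Context {R : realType}.

(** Expanding both arguments in the standard bases gives a finite sum of products of coordinates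
    with fixed vectors, which is jointly continuous. *)
Lemma continuous_bilinear_rV m n (W : normedModType R)
    (b : 'rV[R]_m.+1 -> 'rV[R]_n.+1 -> W) :
  (forall v, linear (b ^~ v)) -> (forall u, linear (b u)) ->
  continuous_bilinear b.
Proof.
move=> bl br; split=> // p.
pose b1 u := HB.pack (b u) (GRing.isLinear.Build _ _ _ _ _ (br u)) :
  {linear 'rV[R]_n.+1 -> W}.
pose b2 v := HB.pack (b ^~ v) (GRing.isLinear.Build _ _ _ _ _ (bl v)) :
  {linear 'rV[R]_m.+1 -> W}.
have E q : b q.1 q.2 =
    \sum_i \sum_j (q.1 0 i * q.2 0 j) *: b (delta_mx 0 i) (delta_mx 0 j).
  rewrite {1}(row_sum_delta q.1) -[LHS]/(b2 q.2 _) linear_sum.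
  apply: eq_bigr => i _; rewrite linearZ /= {1}(row_sum_delta q.2).
  rewrite -[X in _ *: X]/(b1 _ _) linear_sum scaler_sumr.
  by apply: eq_bigr => j _; rewrite linearZ scalerA.
rewrite (_ : (fun p => b p.1 p.2) = (fun q => \sum_i \sum_j
    (q.1 0 i * q.2 0 j) *: b (delta_mx 0 i) (delta_mx 0 j))); last first.
  by apply/funext => q; rewrite E.
rewrite /continuous_at; apply: cvg_big => [|i _]; first exact: add_continuous.
apply: cvg_big => [|j _]; first exact: add_continuous.
apply: cvgZr_tmp; apply: cvgM.
  apply: (@cvg_comp _ _ _ fst (fun v : 'rV[R]_m.+1 => v 0 i)); first exact: cvg_fst.
  exact: coord_continuous.
apply: (@cvg_comp _ _ _ snd (fun v : 'rV[R]_n.+1 => v 0 j)); first exact: cvg_snd.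
exact: coord_continuous.
Qed.

Lemma continuous_bilinear_scale (W : normedModType R) :
  continuous_bilinear (fun (a : R) (w : W) => a *: w).
Proof.
split=> [w a u v|a k u v|]; last exact: scale_continuous.
- by rewrite scalerDl scalerA.
- by rewrite scalerDr !scalerA mulrC.
Qed.

Lemma continuous_bilinear_mul :
  continuous_bilinear (fun a b : R => a * b).
Proof.
split=> [w a u v|a k u v|]; last exact: mul_continuous.
- by rewrite mulrDl scalerAl.
- by rewrite mulrDr scalerAr.
Qed.

End FiniteDimension.

(** * Symmetry of second derivatives *)

Section Schwarz.
Context {R : realType} {V : normedModType R}.

Lemma is_derive_line (W : normedModType R) (f : V -> W) (x u : V) (s : R) :
  differentiable f (s *: u + x) ->
  is_derive s 1 (fun s => f (s *: u + x)) ('D_u f (s *: u + x)).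
Proof.
move=> df; have : derivable f (s *: u + x) u by exact: diff_derivable.
have E : (fun h : R => h^-1 *: (((fun s : R => f (s *: u + x)) \o shift s)
      (h *: 1) - f (s *: u + x))) =
    (fun h : R => h^-1 *: ((f \o shift (s *: u + x)) (h *: u) - f (s *: u + x))).
  apply/funext => h /=; congr (_ *: (f _ - _)).
  by rewrite [h *: 1]mulr1 scalerDl addrA.
rewrite /derivable -E => dv; apply: DeriveDef; first exact: dv.
by rewrite /derive -E.
Qed.

Lemma MVT_line (f : V -> R) (x u : V) (t : R) : 0 < t ->
  (forall s, 0 <= s <= t -> differentiable f (s *: u + x)) ->
  exists2 s, 0 <= s <= t & f (t *: u + x) - f x = 'D_u f (s *: u + x) * t.
Proof.
move=> t0 df.
have D s : 0 <= s <= t ->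
    is_derive s 1 (fun s => f (s *: u + x)) ('D_u f (s *: u + x)).
  by move=> /df; exact: is_derive_line.
have [||s st] := @MVT_segment R (fun s => f (s *: u + x))
    (fun s => 'D_u f (s *: u + x)) 0 t (ltW t0).
- by move=> s; rewrite in_itv /= => /andP[s0 st]; apply: D; rewrite !ltW.
- apply: derivable_within_continuous => s; rewrite in_itv /= => /D Ds.
  exact: ex_derive.
- by rewrite scale0r add0r subr0 => E; exists s.
Qed.

(** The mean value theorem is used twice: along [u] for the increment of [f] in direction [v], then
    along [v] for ['D_u f]. *)
Lemma second_difference (f : V -> R) (x u v : V) (t : R) : 0 < t ->
  (forall a b, 0 <= a <= t -> 0 <= b <= t ->
    differentiable f (a *: u + (b *: v + x)) /\
    differentiable ('D_u f) (a *: u + (b *: v + x))) ->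
  exists a b, [/\ 0 <= a <= t, 0 <= b <= t &
    f (t *: u + (t *: v + x)) - f (t *: u + x) - (f (t *: v + x) - f x)
    = 'D_v ('D_u f) (b *: v + (a *: u + x)) * t * t].
Proof.
move=> t0 H; pose g y := f (t *: v + y) - f y.
have dshift (h : V -> R) y : differentiable h (t *: v + y) ->
    differentiable (fun y => h (t *: v + y)) y.
  by move=> dh; apply: (@differentiable_comp _ _ _ _ (fun y => t *: v + y)).
have [|a ha E] := @MVT_line g x u t t0.
  move=> s hs; apply: differentiableB.
    apply: dshift; rewrite addrCA.
    by have [] := H s t hs; rewrite ?lexx ?ltW.
  by have [] := H s 0 hs; rewrite ?lexx ?ltW// scale0r add0r.
have [|b hb E'] := @MVT_line ('D_u f) (a *: u + x) v t t0.
  by move=> s hs; rewrite addrCA; have [] := H a s ha hs.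
exists a, b; split=> //; rewrite -E'.
have duf y : differentiable f (t *: v + y) -> differentiable f y ->
    'D_u g y = 'D_u f (t *: v + y) - 'D_u f y.
  move=> d1 d2; rewrite [LHS]deriveB.
  - congr (_ - _); apply: (congr1 (fun k : R -> R => lim (k @ (0 : R)^'))).
    by apply/funext => h /=; rewrite addrCA.
  - by apply: diff_derivable; exact: dshift.
  - exact: diff_derivable.
rewrite -duf; last 2 first.
- by rewrite addrCA; have [] := H a t ha; rewrite ?lexx ?ltW.
- by have [] := H a 0 ha; rewrite ?lexx ?ltW// scale0r add0r.
by rewrite -E /g; congr (f _ - _ - _); rewrite addrCA.
Qed.

(** One second difference, evaluated in both orders, equates the two mixed derivatives at two points
    of a small parallelogram; their continuity at [x] closes the gap. *)
Lemma derive_comm_scalar (U : set V) (f : V -> R) (u v x : V) :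
  open U -> Ck_on 2 U f -> U x -> 'D_u ('D_v f) x = 'D_v ('D_u f) x.
Proof.
move=> oU [df Df] Ux.
have dD w : forall y, U y -> differentiable ('D_w f) y by have [] := Df w.
have cD w w' : forall y, U y -> {for y, continuous ('D_w' ('D_w f))}.
  by have [_] := Df w; apply.
apply/eqP; rewrite -subr_eq0 -normr_le0; apply/ler_addgt0Pr => e e0; rewrite add0r.
have e20 : 0 < e / 2 by rewrite divr_gt0.
have /cvgrPdist_le/(_ _ e20) near1 := cD u v x Ux.
have /cvgrPdist_le/(_ _ e20) near2 := cD v u x Ux.
have nU : nbhs x U by exact: open_nbhs_nbhs.
have /nbhs_ballP[d /= d0 B] := @filterI _ _ (nbhs_filter x) _ _ nU
  (@filterI _ _ (nbhs_filter x) _ _ near1 near2).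
(* The summand 1 keeps [M] positive even if [u] and [v] vanish; with [t = d / 2 / M] the
   parallelogram spanned by [t *: u] and [t *: v] stays within distance [d / 2] of [x]. *)
pose M := `|u| + `|v| + 1.
have M0 : 0 < M by rewrite ltr_wpDl// addr_ge0.
pose t := d / 2 / M.
have t0 : 0 < t by rewrite !divr_gt0.
have inB a b : 0 <= a <= t -> 0 <= b <= t -> ball x d (a *: u + (b *: v + x)).
  move=> /andP[a0 at_] /andP[b0 bt].
  rewrite -ball_normE /= distrC addrA addrK.
  rewrite (le_lt_trans (ler_normD _ _))// !normrZ !ger0_norm//.
  apply: (@le_lt_trans _ _ (t * (`|u| + `|v|))).
    by rewrite mulrDr lerD// ler_wpM2r.
  apply: (@le_lt_trans _ _ (t * M)); first by rewrite ler_pM2l// lerDl.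
  by rewrite /t divfK ?gt_eqF// ltr_pdivrMr// ltr_pMr// ltr1n.
have inB' a b : 0 <= a <= t -> 0 <= b <= t -> ball x d (b *: v + (a *: u + x)).
  by move=> ? ?; rewrite addrCA; exact: inB.
have [a [b [ha hb]]] := @second_difference f x u v t t0
  (fun a b ha hb => let: conj U' _ := B _ (inB a b ha hb) in
    conj (df _ U') (dD u _ U')).
have [a' [b' [ha' hb']]] := @second_difference f x v u t t0
  (fun a b ha hb => let: conj U' _ := B _ (inB' b a hb ha) in
    conj (df _ U') (dD v _ U')).
rewrite addrCA opprB addrACA [- _ + - _]addrC => E1 E2.
have E : 'D_u ('D_v f) (b' *: u + (a' *: v + x)) =
    'D_v ('D_u f) (b *: v + (a *: u + x)).
  have tn0 : t != 0 by rewrite gt_eqF.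
  apply: (mulIf tn0); apply: (mulIf tn0); rewrite -E1 -E2; ring.
have [_ [_ /=]] := B _ (inB _ _ hb' ha').
have [_ [+ _ /=]] := B _ (inB' _ _ ha hb); rewrite /= -E => n1 n2.
rewrite (splitr e) (le_trans _ (lerD n2 n1))//.
by rewrite [X in _ <= _ + X]distrC (le_trans _ (ler_normD _ _))// subrKA.
Qed.

End Schwarz.

(** * Algebra of the cross product on R^7 *)

Section CrossProduct.
Context {R : realType}.
Implicit Types u v w : 'rV[R]_7.

Lemma dotE u v : dot u v =
  coord7 u 0 * coord7 v 0 + coord7 u 1 * coord7 v 1 + coord7 u 2 * coord7 v 2
  + coord7 u 3 * coord7 v 3 + coord7 u 4 * coord7 v 4
  + coord7 u 5 * coord7 v 5 + coord7 u 6 * coord7 v 6.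
Proof.
rewrite /dot (eq_bigr (fun i : 'I_7 => coord7 u i * coord7 v i)).
  by rewrite !big_ord_recr big_ord0 /= add0r.
by move=> i _; rewrite /coord7 !inord_val.
Qed.

Lemma coord7P u v : (forall k, (k < 7)%N -> coord7 u k = coord7 v k) -> u = v.
Proof.
move=> H; apply/rowP => i; have := H i (ltn_ord i).
by rewrite /coord7 !inord_val.
Qed.

Lemma coord7D u v k : coord7 (u + v) k = coord7 u k + coord7 v k.
Proof. by rewrite /coord7 mxE. Qed.

Lemma coord7N u k : coord7 (- u) k = - coord7 u k.
Proof. by rewrite /coord7 mxE. Qed.

Lemma coord7Z a u k : coord7 (a *: u) k = a * coord7 u k.
Proof. by rewrite /coord7 mxE. Qed.

(** The octonion multiplication table produced by the three doublings; with it, identities for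
    [cross] become polynomial identities in coordinates. *)
Lemma coord7_cross u v k : (k < 7)%N -> coord7 (cross u v) k =
  let x := coord7 u in let y := coord7 v in
  nth 0 [:: x 1%N * y 2%N - x 2%N * y 1%N + x 3%N * y 4%N
            - x 4%N * y 3%N - x 5%N * y 6%N + x 6%N * y 5%N;
            - x 0%N * y 2%N + x 2%N * y 0%N + x 3%N * y 5%N
            + x 4%N * y 6%N - x 5%N * y 3%N - x 6%N * y 4%N;
            x 0%N * y 1%N - x 1%N * y 0%N + x 3%N * y 6%N
            - x 4%N * y 5%N + x 5%N * y 4%N - x 6%N * y 3%N;
            - x 0%N * y 4%N - x 1%N * y 5%N - x 2%N * y 6%N
            + x 4%N * y 0%N + x 5%N * y 1%N + x 6%N * y 2%N;
            x 0%N * y 3%N - x 1%N * y 6%N + x 2%N * y 5%N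
            - x 3%N * y 0%N - x 5%N * y 2%N + x 6%N * y 1%N;
            x 0%N * y 6%N + x 1%N * y 3%N - x 2%N * y 4%N
            - x 3%N * y 1%N + x 4%N * y 2%N - x 6%N * y 0%N;
            - x 0%N * y 5%N + x 1%N * y 4%N + x 2%N * y 3%N
            - x 3%N * y 2%N - x 4%N * y 1%N + x 5%N * y 0%N] k.
Proof.
move=> k7 /=; rewrite /cross coord7Z {1}/coord7 mxE inordK//.
by move: k k7; do 7 (case=> [_|] /=; first by field).
Qed.

Lemma dot_linearl v : linear ((@dot R)^~ v).
Proof. by move=> a u u'; rewrite !dotE !coord7D !coord7Z -[_ *: _]/(_ * _); ring. Qed.

Lemma dot_linearr u : linear (dot u).
Proof. by move=> a v v'; rewrite !dotE !coord7D !coord7Z -[_ *: _]/(_ * _); ring. Qed.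

Lemma cross_linearl v : linear ((@cross R)^~ v).
Proof.
move=> a u u'; apply: coord7P => k k7.
rewrite coord7D coord7Z !coord7_cross//= !coord7D !coord7Z.
by move: k k7; do 7 (case=> [_|] /=; first by ring).
Qed.

Lemma cross_linearr u : linear (cross u).
Proof.
move=> a v v'; apply: coord7P => k k7.
rewrite coord7D coord7Z !coord7_cross//= !coord7D !coord7Z.
by move: k k7; do 7 (case=> [_|] /=; first by ring).
Qed.

Lemma dotDl u u' v : dot (u + u') v = dot u v + dot u' v.
Proof. by rewrite -[u in LHS]scale1r dot_linearl scale1r. Qed.

Lemma dotDr u v v' : dot u (v + v') = dot u v + dot u v'.
Proof. by rewrite -[v in LHS]scale1r dot_linearr scale1r. Qed.

Lemma dot0l v : dot 0 v = 0.
Proof. by apply: (addrI (dot 0 v)); rewrite -dotDl !addr0. Qed.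

Lemma dot0r u : dot u 0 = 0.
Proof. by apply: (addrI (dot u 0)); rewrite -dotDr !addr0. Qed.

Lemma dotZl a u v : dot (a *: u) v = a * dot u v.
Proof. by rewrite -[a *: u]addr0 dot_linearl dot0l addr0. Qed.

Lemma dotZr a u v : dot u (a *: v) = a * dot u v.
Proof. by rewrite -[a *: v]addr0 dot_linearr dot0r addr0. Qed.

Lemma dotNl u v : dot (- u) v = - dot u v.
Proof. by rewrite -scaleN1r dotZl mulN1r. Qed.

Lemma dotBl u u' v : dot (u - u') v = dot u v - dot u' v.
Proof. by rewrite dotDl dotNl. Qed.

Lemma dot_suml n (a : 'I_n -> 'rV[R]_7) v :
  dot (\sum_i a i) v = \sum_i dot (a i) v.
Proof. exact: (big_morph (dot^~ v) (fun u u' => dotDl u u' v) (dot0l v)). Qed.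

Lemma dot_sumr n u (a : 'I_n -> 'rV[R]_7) :
  dot u (\sum_i a i) = \sum_i dot u (a i).
Proof. exact: (big_morph (dot u) (dotDr u) (dot0r u)). Qed.

Lemma crossDr u v v' : cross u (v + v') = cross u v + cross u v'.
Proof. by rewrite -[v in LHS]scale1r cross_linearr scale1r. Qed.

Lemma cross0r u : cross u 0 = 0.
Proof. by apply: (addrI (cross u 0)); rewrite -crossDr !addr0. Qed.

Lemma crossZr a u v : cross u (a *: v) = a *: cross u v.
Proof. by rewrite -[a *: v]addr0 cross_linearr cross0r addr0. Qed.

Lemma cross_sumr n u (a : 'I_n -> 'rV[R]_7) :
  cross u (\sum_i a i) = \sum_i cross u (a i).
Proof. exact: (big_morph (cross u) (crossDr u) (cross0r u)). Qed.

Lemma dot_bilinear : continuous_bilinear (@dot R).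
Proof. exact: continuous_bilinear_rV dot_linearl dot_linearr. Qed.

Lemma cross_bilinear : continuous_bilinear (@cross R).
Proof. exact: continuous_bilinear_rV cross_linearl cross_linearr. Qed.

Lemma dotC u v : dot u v = dot v u.
Proof. by rewrite !dotE; ring. Qed.

Lemma dot_eq0 u : (dot u u == 0) = (u == 0).
Proof.
apply/eqP/eqP => [|->]; last by rewrite dot0l.
rewrite /dot => /psumr_eq0P H; apply/rowP => i; rewrite mxE.
have /eqP := H (fun j _ => sqr_ge0 (u 0 j)) i isT.
by rewrite mulf_eq0 orbb => /eqP.
Qed.

Lemma crossC u v : cross u v = - cross v u.
Proof.
apply: coord7P => k k7; rewrite coord7N !coord7_cross//=.
by move: k k7; do 7 (case=> [_|] /=; first by ring).
Qed.

Lemma dot_cross_cyclic u v w : dot (cross u v) w = dot (cross v w) u.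
Proof. by rewrite !dotE !coord7_cross//=; ring. Qed.

End CrossProduct.

(** Polarization of u x (u x w) = <u,w> u - |u|^2 w. Its case of orthogonal [u] and [v] lets [F] be
    moved past a tangent vector in a double product. *)
Lemma cross_cross (R : realType) (u v w : 'rV[R]_7) :
  cross u (cross v w) + cross v (cross u w) =
  dot u w *: v + dot v w *: u - (2 * dot u v) *: w.
Proof.
have cE a b := (@coord7_cross R a b 0 isT, @coord7_cross R a b 1 isT,
  @coord7_cross R a b 2 isT, @coord7_cross R a b 3 isT,
  @coord7_cross R a b 4 isT, @coord7_cross R a b 5 isT,
  @coord7_cross R a b 6 isT).
rewrite /= in cE.
apply: coord7P => k k7.
rewrite [LHS]coord7D.
rewrite [X in _ = X]coord7D [X in _ = X + _]coord7D coord7N.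
rewrite (coord7Z (dot u w)) (coord7Z (dot v w)) (coord7Z (2 * dot u v)).
(* Generalizing [coord7] and [cross] leaves only their coordinate formulas, so [ring] cannot unfold
   them. *)
rewrite !dotE; move: (@coord7 R) (@cross R) cE k k7 => c x cE.
do 7 (case=> [_|]; first by rewrite !cE; ring).
by [].
Qed.

(** * Derivatives along vector fields *)

Section DerivativeFields.
Context {R : realType}.

Lemma derive_eq_on (V W : normedModType R) (U : set V) (f g : V -> W) (v x : V) :
  open U -> (forall y, U y -> f y = g y) -> U x -> 'D_v f x = 'D_v g x.
Proof.
move=> oU fg Ux; apply: near_eq_derive.
by apply: (open_near_eq oU) => // y; rewrite inE => /fg.
Qed.

Lemma derive_linear (V W : normedModType R) (f : V -> W) (x : V) :
  differentiable f x -> linear (fun v => 'D_v f x).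
Proof. by move=> df a u v; rewrite !deriveE// linearP. Qed.

Lemma derive_sumv (V W : normedModType R) (f : V -> W) (x : V) n
    (a : 'I_n -> R) (u : 'I_n -> V) :
  differentiable f x ->
  'D_(\sum_i a i *: u i) f x = \sum_i a i *: 'D_(u i) f x.
Proof.
move=> df; rewrite deriveE// linear_sum; apply: eq_bigr => i _.
by rewrite linearZ deriveE.
Qed.

Lemma derive_row (W : normedModType R) n (f : 'rV[R]_n.+1 -> W) x (v : 'rV[R]_n.+1) :
  differentiable f x -> 'D_v f x = \sum_i v 0 i *: 'D_(delta_mx 0 i) f x.
Proof. by move=> df; rewrite {1}(row_sum_delta v) derive_sumv. Qed.

Lemma derive_sum_fun (V W : normedModType R) n (f : 'I_n -> V -> W) (v x : V) :
  (forall i, differentiable (f i) x) ->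
  'D_v (fun y => \sum_i f i y) x = \sum_i 'D_v (f i) x.
Proof.
move=> df.
rewrite (_ : (fun y => _) = \sum_i f i); last first.
  by apply/funext => y; rewrite fct_sumE.
by rewrite derive_sum// => i; apply: diff_derivable.
Qed.

Section Coordinate.
Variables (V : normedModType R) (n : nat) (U : set V).

(** A coordinate is the pairing with a basis vector, which brings coordinates under the bilinear
    lemmas. *)
Let rdot (u v : 'rV[R]_n.+1) : R := (u *m v^T) 0 0.

Let rdot_bilinear : continuous_bilinear rdot.
Proof.
apply: continuous_bilinear_rV => [v a u u'|u a v v']; rewrite /rdot.
- by rewrite mulmxDl -scalemxAl !mxE.
- by rewrite linearP /= mulmxDr -scalemxAr !mxE.
Qed.

Let rdot_delta (u : 'rV[R]_n.+1) i : rdot u (delta_mx 0 i) = u 0 i.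
Proof.
rewrite /rdot mxE (bigD1 i)//= big1 ?addr0; first by rewrite !mxE !eqxx mulr1.
by move=> j ji; rewrite !mxE (negbTE ji) andbF mulr0.
Qed.

Lemma smooth_on_coord (f : V -> 'rV[R]_n.+1) i :
  open U -> smooth_on U f -> smooth_on U (fun x => f x 0 i).
Proof.
move=> oU sf.
rewrite (_ : (fun x => f x 0 i) = fun x => rdot (f x) (delta_mx 0 i)).
  exact: smooth_on_bilinear rdot_bilinear sf (smooth_on_cst _ _).
by apply/funext => x; rewrite rdot_delta.
Qed.

Lemma differentiable_coordf (f : V -> 'rV[R]_n.+1) i x :
  differentiable f x -> differentiable (fun x => f x 0 i) x.
Proof.
move=> df.
rewrite (_ : (fun x => f x 0 i) = fun x => rdot (f x) (delta_mx 0 i)).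
  exact: (differentiable_bilinear rdot_bilinear (g := cst (delta_mx 0 i)) df).
by apply/funext => y; rewrite rdot_delta.
Qed.

Lemma derive_coord (f : V -> 'rV[R]_n.+1) i v x :
  differentiable f x -> 'D_v (fun x => f x 0 i) x = 'D_v f x 0 i.
Proof.
move=> df.
rewrite (_ : (fun x => f x 0 i) = fun x => rdot (f x) (delta_mx 0 i)).
  rewrite (derive_bilinear rdot_bilinear (g := cst (delta_mx 0 i)))//.
  by rewrite derive_cst rdot_delta /rdot trmx0 mulmx0 mxE addr0.
by apply/funext => y; rewrite rdot_delta.
Qed.

End Coordinate.

Section Field.
Variables (n : nat) (U : set 'rV[R]_n.+1).
Hypothesis oU : open U.

Lemma smooth_on_derive_field (W : normedModType R) (X : 'rV[R]_n.+1 -> 'rV[R]_n.+1)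
    (f : 'rV[R]_n.+1 -> W) :
  smooth_on U X -> smooth_on U f -> smooth_on U (fun x => 'D_(X x) f x).
Proof.
move=> sX sf.
apply: (smooth_on_eq oU (f := fun x => \sum_i X x 0 i *: 'D_(delta_mx 0 i) f x)).
  move=> x; rewrite inE => Ux; rewrite [RHS]derive_row//.
  exact: smooth_on_differentiable sf Ux.
apply: (smooth_on_sum oU) => i.
apply: (smooth_on_bilinear oU (@continuous_bilinear_scale R W)).
  exact: smooth_on_coord.
exact: smooth_on_derive.
Qed.

(** The product rule for ['D_(X y) f y] as a sum of coordinates of [X] times partial derivatives:
    the first term freezes the direction at [x], the second differentiates it. *)
Lemma derive_derive_field (W : normedModType R) (X : 'rV[R]_n.+1 -> 'rV[R]_n.+1)
    (f : 'rV[R]_n.+1 -> W) u x :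
  U x -> differentiable X x -> smooth_on U f ->
  'D_u (fun y => 'D_(X y) f y) x = 'D_u ('D_(X x) f) x + 'D_('D_u X x) f x.
Proof.
move=> Ux dX sf.
have df y : U y -> differentiable f y by exact: smooth_on_differentiable.
have dDf i : differentiable ('D_(delta_mx 0 i) f) x.
  exact: smooth_on_differentiable (smooth_on_derive _ sf) Ux.
rewrite (derive_eq_on (g := fun y => \sum_i X y 0 i *: 'D_(delta_mx 0 i) f y)
  _ oU)//; last first.
  by move=> y Uy; rewrite derive_row//; exact: df.
rewrite [in X in _ = X + _](derive_eq_on
  (g := fun y => \sum_i X x 0 i *: 'D_(delta_mx 0 i) f y) _ oU)//; last first.
  by move=> y Uy; rewrite derive_row//; exact: df.
have sb := @continuous_bilinear_scale R W.
rewrite !derive_sum_fun; last 2 first.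
- by move=> i; apply: (differentiable_bilinear sb (f := cst (X x 0 i))).
- by move=> i; apply: (differentiable_bilinear sb) => //; exact: differentiable_coordf.
rewrite (derive_row _ (df x Ux)) -big_split /=; apply: eq_bigr => i _.
rewrite (derive_bilinear sb)//; last exact: differentiable_coordf.
rewrite (derive_bilinear sb (f := cst (X x 0 i)))// derive_cst scale0r add0r.
by rewrite derive_coord// addrC.
Qed.

End Field.

(** Pairing with a fixed vector reduces to the scalar case, and [dot] is definite. *)
Lemma derive_comm (V : normedModType R) (U : set V) (f : V -> 'rV[R]_7) (u v x : V) :
  open U -> smooth_on U f -> U x -> 'D_u ('D_v f) x = 'D_v ('D_u f) x.
Proof.
move=> oU sf Ux.
have H w u' v' : dot ('D_u' ('D_v' f) x) w = 'D_u' ('D_v' (fun y => dot (f y) w)) x.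
  have dE v'' (g : V -> 'rV[R]_7) y : smooth_on U g -> U y ->
      'D_v'' (fun y => dot (g y) w) y = dot ('D_v'' g y) w.
    move=> sg Uy; rewrite (derive_bilinear dot_bilinear (g := cst w))//.
      by rewrite derive_cst dot0r addr0.
    exact: smooth_on_differentiable sg Uy.
  rewrite (derive_eq_on (g := fun y => dot ('D_v' f y) w) _ oU)//.
    by rewrite dE//; exact: smooth_on_derive.
  by move=> y Uy; rewrite dE.
have Z w : dot ('D_u ('D_v f) x) w = dot ('D_v ('D_u f) x) w.
  have sw : smooth_on U (fun y => dot (f y) w).
    exact: (smooth_on_bilinear oU dot_bilinear sf (smooth_on_cst U w)).
  apply: etrans (H w u v) (etrans _ (esym (H w v u))).
  exact: (derive_comm_scalar u v oU (sw 2%N) Ux).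
move: ('D_u ('D_v f) x) ('D_v ('D_u f) x) Z => a b Z.
by apply/eqP; rewrite -subr_eq0 -dot_eq0 dotBl Z subrr.
Qed.

End DerivativeFields.

(** * Lagrange identity for the cross product *)

Section CrossIdentities.
Context {R : realType}.
Implicit Types u v w : 'rV[R]_7.

Lemma crossvv u : cross u u = 0.
Proof.
apply/eqP; have /eqP := crossC u u; rewrite -subr_eq0 opprK -mulr2n.
by rewrite -scaler_nat scaler_eq0 pnatr_eq0.
Qed.

Lemma dot_crossC u v w : dot (cross u v) w = - dot (cross u w) v.
Proof. by rewrite 2![LHS]dot_cross_cyclic (crossC w) dotNl. Qed.

Lemma dot_cross_cross u v w : dot (cross u v) (cross u w) =
  dot u u * dot v w - dot u v * dot u w.
Proof.
have H : cross u (cross u w) = dot u w *: u - dot u u *: w.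
  apply: (scalerI (_ : 2 != 0 :> R)); first by rewrite pnatr_eq0.
  rewrite scaler_nat mulr2n cross_cross scalerBr !scalerA.
  by congr (_ - _); rewrite -scalerDl mulr_natl mulr2n.
by rewrite dot_crossC H dotBl !dotZl (dotC w); ring.
Qed.

End CrossIdentities.

(** * Three indices and the alternating symbol *)

Section Ord3.
Context {R : realType}.

Definition o0 : 'I_3 := @Ordinal 3 0 isT.
Definition o1 : 'I_3 := @Ordinal 3 1 isT.
Definition o2 : 'I_3 := @Ordinal 3 2 isT.

Lemma ord3_ind (P : 'I_3 -> Prop) : P o0 -> P o1 -> P o2 -> forall i, P i.
Proof.
move=> P0 P1 P2 [[|[|[|//]]] i3].
- by rewrite (_ : Ordinal _ = o0)//; exact: val_inj.
- by rewrite (_ : Ordinal _ = o1)//; exact: val_inj.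
- by rewrite (_ : Ordinal _ = o2)//; exact: val_inj.
Qed.

Lemma sum3E (V : nmodType) (f : 'I_3 -> V) : \sum_i f i = f o0 + f o1 + f o2.
Proof.
rewrite !big_ord_recr big_ord0 /= add0r.
by congr (f _ + f _ + f _); apply: val_inj.
Qed.

(* A Vandermonde product, so that the antisymmetry of [eps] is a ring identity. *)
Definition eps (i j k : 'I_3) : R :=
  (j%:R - i%:R) * (k%:R - i%:R) * (k%:R - j%:R) / 2.

Lemma epsE : (eps o0 o1 o2 = 1) * (eps o1 o2 o0 = 1) * (eps o2 o0 o1 = 1) *
  (eps o1 o0 o2 = -1) * (eps o0 o2 o1 = -1) * (eps o2 o1 o0 = -1) *
  (forall i k, eps i i k = 0) * (forall i k, eps i k i = 0) *
  (forall i k, eps k i i = 0).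
Proof.
split; last by move=> i k; rewrite /eps; ring.
split; last by move=> i k; rewrite /eps; ring.
split; last by move=> i k; rewrite /eps; ring.
by rewrite /eps /=; do !split; field.
Qed.

(** Skewness in the first pair and cyclic invariance generate all permutations, and in dimension
    three an alternating array has a single free entry. *)
Lemma alternating3 (w : 'I_3 -> 'I_3 -> 'I_3 -> R) :
  (forall i j k, w i j k = - w j i k) -> (forall i j k, w i j k = w j k i) ->
  forall i j k, w i j k = w o0 o1 o2 * eps i j k.
Proof.
move=> wN wC.
have w0 i k : w i i k = 0 by have := wN i i k; lra.
have w0' i k : w i k i = 0 by rewrite -wC w0.
have w0'' i k : w k i i = 0 by rewrite wC w0.
have w120 : w o1 o2 o0 = w o0 o1 o2 by rewrite -wC.
have w201 : w o2 o0 o1 = w o0 o1 o2 by rewrite wC.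
have w102 : w o1 o0 o2 = - w o0 o1 o2 by rewrite wN.
have w021 : w o0 o2 o1 = - w o0 o1 o2 by rewrite wN w201.
have w210 : w o2 o1 o0 = - w o0 o1 o2 by rewrite wN w120.
by do 3 elim/ord3_ind; rewrite !epsE ?w0 ?w0' ?w0'' ?w120 ?w201 ?w102 ?w021 ?w210;
  rewrite ?mulr1 ?mulr0 ?mulrN1.
Qed.

End Ord3.

(** * Tensor algebra at one point *)

Section PointwiseAlgebra.
Context {R : realType}.

(* The difference of the two sides is four times the squared norm of the totally
   symmetric trace-free part [S] of [P]. *)
Lemma sqnorm_traceless (P : 'I_3 -> 'I_3 -> 'I_3 -> R) (W A : 'I_3 -> 'I_3 -> R) :
  (forall i j k, P i j k = P i k j) -> (forall i, \sum_j P i j j = 0) ->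
  (forall i j, W i j = \sum_a \sum_b eps i a b * P a b j) ->
  (forall i j, A i j = 2^-1 * (W i j + W j i)) ->
  9 / 10 * (\sum_k (\sum_i P i i k) ^+ 2) - 3^-1 * (\sum_i \sum_j A i j ^+ 2)
  <= \sum_i \sum_j \sum_k P i j k ^+ 2
     + 3 * (\sum_i \sum_j \sum_k P i j k * P j i k).
Proof.
move=> Psym Ptr WE AE; rewrite -subr_ge0.
pose v k := \sum_i P i i k.
pose d (i j : 'I_3) : R := (i == j)%:R.
(* As [P] is symmetric in its last two indices, three terms symmetrize it. The result has trace 2/3
   of [v], and the bracket with [d] has trace 5 times [v], whence 2/15. *)
pose S i j k := (P i j k + P j k i + P k i j) / 3
  - (2 / 15) * (d i j * v k + d j k * v i + d k i * v j).
suff -> : (\sum_i \sum_j \sum_k P i j k ^+ 2 +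
    3 * (\sum_i \sum_j \sum_k P i j k * P j i k) -
   (9 / 10 * (\sum_k (\sum_i P i i k) ^+ 2) -
    3^-1 * (\sum_i \sum_j A i j ^+ 2))) = 4 * \sum_i \sum_j \sum_k S i j k ^+ 2.
  by rewrite mulr_ge0// !sumr_ge0// => i _; rewrite sumr_ge0// => j _;
    rewrite sumr_ge0// => k _; rewrite sqr_ge0.
have P22 i : P i o2 o2 = - P i o0 o0 - P i o1 o1.
  by have := Ptr i; rewrite sum3E; lra.
rewrite /S /v /d !sum3E !AE !WE !sum3E !epsE /=.
rewrite !(Psym _ o1 o0) !(Psym _ o2 o0) !(Psym _ o2 o1) !P22.
(* The fifteen independent entries of a tensor in R^3 (x) Sym^2_0(R^3). *)
move: (P o0 o0 o0) (P o0 o0 o1) (P o0 o0 o2) (P o0 o1 o1) (P o0 o1 o2)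
  (P o1 o0 o0) (P o1 o0 o1) (P o1 o0 o2) (P o1 o1 o1) (P o1 o1 o2)
  (P o2 o0 o0) (P o2 o0 o1) (P o2 o0 o2) (P o2 o1 o1) (P o2 o1 o2).
by move=> *; field.
Qed.

Section Point.
Variables (h : 'I_3 -> 'I_3 -> 'I_3 -> R) (dh : 'I_3 -> 'I_3 -> 'I_3 -> 'I_3 -> R).
Variables (Gam : 'I_3 -> 'I_3 -> 'I_3 -> R).
Hypothesis h12 : forall i j k, h i j k = h j i k.
Hypothesis h23 : forall i j k, h i j k = h i k j.
Hypothesis htr : forall i, \sum_j h i j j = 0.
Hypothesis dh_symm12 : forall l i j k, dh l i j k = dh l j i k.
Hypothesis dh_symm23 : forall l i j k, dh l i j k = dh l i k j.
Hypothesis dhtr : forall l i, \sum_j dh l i j j = 0.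
Hypothesis connC : forall i j k, Gam i j k = - Gam i k j.
(** The [N l] component of D_i D_j E_k - D_j D_i E_k = D_[e_i,e_j] E_k in flat R^7. The [eps] terms
    come from differentiating [F] in N = F x E. *)
Hypothesis codazzi : forall i j k l,
  (dh i j k l + \sum_m Gam j k m * h i m l
   - \sum_m h j k m * (eps i l m + Gam i l m))
  - (dh j i k l + \sum_m Gam i k m * h j m l
     - \sum_m h i k m * (eps j l m + Gam j l m))
  = \sum_m (Gam i j m - Gam j i m) * h m k l.

(* Components of the covariant derivative of the cubic form [h]. *)
Let H l i j k := dh l i j k - \sum_m Gam l i m * h m j k
  - \sum_m Gam l j m * h i m k - \sum_m Gam l k m * h i j m.

(** [Tc] written in the frame: the derivative of N_m along e_l has N_k component eps_lmk + Gam_lmk,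
    and the last line collects the three terms in [G]. *)
Definition T_components l i j k :=
  dh l i j k + \sum_m h i j m * (eps l m k + Gam l m k)
  - \sum_m Gam l i m * h m j k - \sum_m Gam l j m * h i m k
  - 4^-1 * (\sum_m h i m j * eps l m k + \sum_m h j m l * eps i m k
            + \sum_m h l m i * eps j m k).

Let T := T_components.

(** The difference between nabla h and [H]: the normal connection differs by [eps] from the tangent
    connection transported by J. *)
Let Q l i j k : R := \sum_m h i j m * eps l m k.

Let epsN i j k : eps i j k = - eps i k j :> R.
Proof. by rewrite /eps; field. Qed.

Let connV a b : Gam a b b = 0.
Proof. by have := connC a b b; lra. Qed.

Let hE := (fun k => h12 o1 o0 k, fun k => h12 o2 o0 k, fun k => h12 o2 o1 k,
  fun i => h23 i o1 o0, fun i => h23 i o2 o0, fun i => h23 i o2 o1).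

Let htrE i : h i o2 o2 = - h i o0 o0 - h i o1 o1.
Proof. by have := htr i; rewrite sum3E; lra. Qed.

Lemma H_symm12 l i j k : H l i j k = H l j i k.
Proof.
rewrite /H dh_symm12.
have -> : \sum_m Gam l i m * h m j k = \sum_m Gam l i m * h j m k.
  by apply: eq_bigr => m _; rewrite h12.
have -> : \sum_m Gam l j m * h i m k = \sum_m Gam l j m * h m i k.
  by apply: eq_bigr => m _; rewrite h12.
have -> : \sum_m Gam l k m * h i j m = \sum_m Gam l k m * h j i m.
  by apply: eq_bigr => m _; rewrite h12.
ring.
Qed.

Lemma H_symm23 l i j k : H l i j k = H l i k j.
Proof.
rewrite /H dh_symm23.
have -> : \sum_m Gam l i m * h m j k = \sum_m Gam l i m * h m k j.
  by apply: eq_bigr => m _; rewrite h23.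
have -> : \sum_m Gam l j m * h i m k = \sum_m Gam l j m * h i k m.
  by apply: eq_bigr => m _; rewrite h23.
have -> : \sum_m Gam l k m * h i j m = \sum_m Gam l k m * h i m j.
  by apply: eq_bigr => m _; rewrite h23.
ring.
Qed.

(** The connection terms vanish: one contains a trace of [h], the other two pair the skew [Gam] with
    a symmetric array. *)
Lemma H_trace l i : \sum_j H l i j j = 0.
Proof.
have dE : dh l i o2 o2 = - dh l i o0 o0 - dh l i o1 o1.
  by have := dhtr l i; rewrite sum3E; lra.
rewrite /H !sum3E dE !connV (connC l o1 o0) (connC l o2 o0) (connC l o2 o1).
rewrite !htrE !(h23 _ o1 o0) !(h23 _ o2 o0) !(h23 _ o2 o1); ring.
Qed.

(** Of the three correction terms one is [Q l i j k] itself, so its coefficient drops from 1 to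
    3/4. *)
Lemma T_eq_H l i j k : T l i j k =
  H l i j k + 3 / 4 * Q l i j k - 4^-1 * Q i l j k - 4^-1 * Q j l i k.
Proof.
rewrite /T /T_components /H /Q.
have -> : \sum_m h i j m * (eps l m k + Gam l m k) =
    \sum_m h i j m * eps l m k - \sum_m Gam l k m * h i j m.
  by rewrite -sumrB; apply: eq_bigr => m _; rewrite (connC l k m); ring.
have E a b c d : \sum_m h a m b * eps c m d = \sum_m h a b m * eps c m d :> R.
  by apply: eq_bigr => m _; rewrite h23.
rewrite !E.
have -> : \sum_m h j l m * eps i m k = \sum_m h l j m * eps i m k :> R.
  by apply: eq_bigr => m _; rewrite h12.
by field.
Qed.

Lemma Q_symm23 l i j k : Q l i j k = Q l j i k.
Proof. by apply: eq_bigr => m _; rewrite h12. Qed.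

(** By Codazzi, [H] fails to be symmetric in [l], [i] by [Q i l j k - Q l i j k]. The weights 3/4
    and -1/4 differ by exactly 1, so the defect cancels. *)
Lemma T_symm12 l i j k : T l i j k = T i l j k.
Proof.
suff : H l i j k - H i l j k = Q i l j k - Q l i j k.
  by rewrite !T_eq_H (Q_symm23 j l i); lra.
have := codazzi l i j k; rewrite /H /Q !sum3E !(epsN l k) !(epsN i k); lra.
Qed.

Lemma T_symm23 l i j k : T l i j k = T l j i k.
Proof. by rewrite !T_eq_H H_symm12 (Q_symm23 l i j); ring. Qed.

(** Contracting the [Q] terms with eps_njk, with [h] symmetric and trace-free, gives -3/4, 1/4 and
    1/2 times h_lin, which add up to zero; the proof checks this entry by entry. *)
Lemma T_symm34 l i j k : T l i j k = T l i k j.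
Proof.
rewrite !T_eq_H (H_symm23 l i j k) -!addrA; congr (_ + _); rewrite /Q.
by move: l i j k; do 4 elim/ord3_ind; rewrite !sum3E !epsE ?hE
  ?htrE ?hE; field.
Qed.

Lemma T_trace l i : \sum_j T l i j j = 0.
Proof.
under eq_bigr do rewrite T_eq_H.
rewrite !sumrB big_split /= H_trace /Q !sum3E !epsE !(epsN _ o1 o0) !(epsN _ o2 o0)
  !(epsN _ o2 o1) !(h23 _ o1 o0) !(h23 _ o2 o0) !(h23 _ o2 o1); ring.
Qed.

Lemma sum_hH l : \sum_i \sum_j \sum_k h i j k * H l i j k =
  \sum_i \sum_j \sum_k h i j k * dh l i j k.
Proof.
rewrite /H !sum3E !connV (connC l o1 o0) (connC l o2 o0) (connC l o2 o1); ring.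
Qed.

Lemma sum_hQ l : \sum_i \sum_j \sum_k h i j k * Q l i j k = 0.
Proof.
rewrite /Q !sum3E !epsE !(epsN l o1 o0) !(epsN l o2 o0) !(epsN l o2 o1); ring.
Qed.

Lemma sum_hQ' l : \sum_i \sum_j \sum_k h i j k * Q i l j k = 0.
Proof.
rewrite /Q !sum3E !epsE !hE ?(h12 o2 o1) ?(h12 o1 o0); ring.
Qed.

Lemma sum_hQ'' l : \sum_i \sum_j \sum_k h i j k * Q j l i k = 0.
Proof.
rewrite exchange_big -[RHS](sum_hQ' l); apply: eq_bigr => i _.
by apply: eq_bigr => j _; apply: eq_bigr => k _; rewrite h12.
Qed.

(** Each [Q] term pairs a symmetric product of entries of [h] with a skew [eps], and each connection
    term with a skew [Gam], so only the plain derivative survives. *)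
Lemma sum_hT l : \sum_i \sum_j \sum_k h i j k * T l i j k =
  \sum_i \sum_j \sum_k h i j k * dh l i j k.
Proof.
transitivity (\sum_i \sum_j \sum_k h i j k * H l i j k
  + 3 / 4 * (\sum_i \sum_j \sum_k h i j k * Q l i j k)
  - 4^-1 * (\sum_i \sum_j \sum_k h i j k * Q i l j k)
  - 4^-1 * (\sum_i \sum_j \sum_k h i j k * Q j l i k)).
  rewrite !mulr_sumr -big_split -!sumrB; apply: eq_bigr => i _.
  rewrite !mulr_sumr -big_split -!sumrB; apply: eq_bigr => j _.
  rewrite !mulr_sumr -big_split -!sumrB; apply: eq_bigr => k _.
  by rewrite T_eq_H /=; ring.
by rewrite sum_hQ sum_hQ' sum_hQ'' sum_hH !mulr0 !subr0 addr0.
Qed.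

Definition P_components i j k := \sum_a \sum_b h a b i * T a b j k.
Let P := P_components.

Lemma P_symm23 i j k : P i j k = P i k j.
Proof. by apply: eq_bigr => a _; apply: eq_bigr => b _; rewrite T_symm34. Qed.

Lemma P_trace23 i : \sum_j P i j j = 0.
Proof.
rewrite /P /P_components exchange_big big1// => a _.
rewrite exchange_big big1// => b _.
by rewrite -mulr_sumr T_trace mulr0.
Qed.

Lemma P_trace12 l : \sum_i P i i l = \sum_i \sum_j \sum_k h i j k * dh l i j k.
Proof.
rewrite -sum_hT /P /P_components exchange_big; apply: eq_bigr => a _.
rewrite exchange_big; apply: eq_bigr => b _; apply: eq_bigr => i _.
by rewrite T_symm34 T_symm23 T_symm12.
Qed.

End Point.
End PointwiseAlgebra.

(** * The adapted frame F, E_i, N_i along the immersion *)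

Section MovingFrame.
Context {R : realType}.
Variables (U : set 'rV[R]_3) (F : 'rV[R]_3 -> 'rV[R]_7).
Variable e : 'I_3 -> 'rV[R]_3 -> 'rV[R]_3.
Hypotheses (oU : open U) (sF : smooth_on U F) (se : forall i, smooth_on U (e i)).
(* The derived fields are variables tied to their definitions by equations, so
   that unification never unfolds a directional derivative. *)
Variables E N : 'I_3 -> 'rV[R]_3 -> 'rV[R]_7.
Variable dF : 'rV[R]_3 -> 'rV[R]_3 -> 'rV[R]_7.
Variable D : 'I_3 -> ('rV[R]_3 -> 'rV[R]_7) -> 'rV[R]_3 -> 'rV[R]_7.
Hypothesis dFE : dF = fun u x => 'D_u F x.
Hypothesis EE : E = fun i => push F (e i).
Hypothesis NE : N = fun i => J F (E i).
Hypothesis DE : D = fun i V x => 'D_(e i x) V x.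

Hypothesis FF : forall x, U x -> dot (F x) (F x) = 1.
Hypothesis lagrangian : forall x u v, U x ->
  dot (cross (F x) (dF u x)) (dF v x) = 0.
Hypothesis normalE : forall x w, U x -> dot w (F x) = 0 ->
  (forall u, dot w (dF u x) = 0) -> exists u, w = cross (F x) (dF u x).
Hypothesis orthonormal : forall x i j, U x -> dot (E i x) (E j x) = (i == j)%:R.

Let differentiable_F x : U x -> differentiable F x.
Proof. exact: smooth_on_differentiable sF. Qed.

Lemma frame_dF i x : E i x = dF (e i x) x.
Proof. by rewrite EE dFE. Qed.

Lemma normal_cross i x : N i x = cross (F x) (E i x).
Proof. by rewrite NE. Qed.

Lemma smooth_frame i : smooth_on U (E i).
Proof. by rewrite EE; exact: smooth_on_derive_field. Qed.

Lemma smooth_normal i : smooth_on U (N i).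
Proof. by rewrite NE; exact: smooth_on_bilinear cross_bilinear _ (smooth_frame i). Qed.

Lemma smooth_D i V : smooth_on U V -> smooth_on U (D i V).
Proof. by rewrite DE; exact: smooth_on_derive_field. Qed.

Lemma dF_sum x n (a : 'I_n -> R) (u : 'I_n -> 'rV[R]_3) : U x ->
  dF (\sum_i a i *: u i) x = \sum_i a i *: dF (u i) x.
Proof. by move=> Ux; rewrite dFE; apply: derive_sumv; exact: differentiable_F. Qed.

Lemma dF_row x u : U x -> dF u x = \sum_i u 0 i *: dF (delta_mx 0 i) x.
Proof. by move=> Ux; rewrite {1}(row_sum_delta u) dF_sum. Qed.

Lemma dot_dFF x v : U x -> dot (dF v x) (F x) = 0.
Proof.
move=> Ux; have : 'D_v (fun y => dot (F y) (F y)) x = 0.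
  by rewrite (@derive_eq_on R _ R U _ (cst 1) v x oU FF Ux) derive_cst.
rewrite (derive_bilinear dot_bilinear); [|exact: differentiable_F..].
rewrite -[LHS]/(dot ((fun u x => 'D_u F x) v x) _
  + dot _ ((fun u x => 'D_u F x) v x)) -dFE.
by rewrite [X in _ + X]dotC -mulr2n => /eqP; rewrite mulrn_eq0 => /eqP.
Qed.

Lemma dot_EF x i : U x -> dot (E i x) (F x) = 0.
Proof. by move=> Ux; rewrite frame_dF dot_dFF. Qed.

Lemma dot_NF x i : dot (N i x) (F x) = 0.
Proof. by rewrite normal_cross dot_crossC crossvv dot0l oppr0. Qed.

Lemma dot_dFN x v i : U x -> dot (dF v x) (N i x) = 0.
Proof. by move=> Ux; rewrite dotC normal_cross frame_dF lagrangian. Qed.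

Lemma dot_EN x i j : U x -> dot (E i x) (N j x) = 0.
Proof. by move=> Ux; rewrite frame_dF dot_dFN. Qed.

Lemma dot_FcrossN x w i : U x ->
  dot (cross (F x) w) (N i x) = dot w (E i x).
Proof.
move=> Ux; rewrite normal_cross dot_cross_cross FF// mul1r.
by rewrite [dot (F x) (E i x)]dotC dot_EF// mulr0 subr0.
Qed.

Lemma dot_NN x i j : U x -> dot (N i x) (N j x) = (i == j)%:R.
Proof. by move=> Ux; rewrite {1}normal_cross dot_FcrossN// orthonormal. Qed.

(** Orthonormality reads B * gram * B^T = 1, with the frame coordinates as rows of [B]; the inverse
    Gram matrix is therefore B^T * B. *)
Lemma gram_inv x : U x -> let B := \matrix_(m, i) e m x 0 i : 'M[R]_3 in
  gram F x *m (B^T *m B) = 1%:M.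
Proof.
move=> Ux B.
rewrite mulmxA; apply: mulmx1C.
apply/matrixP => i j; rewrite !mxE -(orthonormal i j Ux) !frame_dF
  (dF_row (e i x) Ux) (dF_row (e j x) Ux).
rewrite dot_suml; apply: eq_bigr => k _; rewrite !mxE dotZl.
rewrite dot_sumr; congr (_ * _); apply: eq_bigr => l _.
by rewrite !mxE dotZr mulrC dFE.
Qed.

Lemma gram_unit x : U x -> gram F x \in unitmx.
Proof. by move=> /gram_inv /mulmx1_unit[]. Qed.

(** Replaces the inverse Gram matrix by a frame expansion; gradients, shape operators and
    Christoffel symbols enter the frame through it. *)
Lemma raiseE x a : U x ->
  raise F a x = \sum_m (\sum_i a i * e m x 0 i) *: e m x.
Proof.
move=> Ux; pose B := \matrix_(m, i) e m x 0 i : 'M[R]_3.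
rewrite /raise (_ : invmx (gram F x) = B^T *m B); last first.
  by rewrite -[RHS](mulKmx (gram_unit Ux)) gram_inv// mulmx1.
apply/rowP => j; rewrite mulmxA mxE summxE; apply: eq_bigr => m _.
rewrite !mxE; congr (_ * _); apply: eq_bigr => i _.
by rewrite !mxE.
Qed.

Lemma frame_decomp x u : U x -> u = \sum_m dot (dF u x) (E m x) *: e m x.
Proof.
move=> Ux; transitivity (raise F (fun i => (u *m gram F x) 0 i) x).
  rewrite /raise (_ : \row_i _ = u *m gram F x) ?mulmxK ?gram_unit//.
  by apply/rowP => i; rewrite mxE.
rewrite raiseE//; apply: eq_bigr => m _; congr (_ *: _).
rewrite frame_dF (dF_row (e m x) Ux) dot_sumr; apply: eq_bigr => i _.
rewrite dotZr mulrC mxE (dF_row u Ux) dot_suml; congr (_ * _).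
by apply: eq_bigr => j _; rewrite mxE dotZl dFE.
Qed.

Lemma dF_decomp x u : U x -> dF u x = \sum_m dot (dF u x) (E m x) *: E m x.
Proof.
move=> Ux; rewrite {1}(frame_decomp u Ux) dF_sum//.
by apply: eq_bigr => m _; rewrite -frame_dF.
Qed.

Lemma adapted_decomp x w : U x ->
  w = dot w (F x) *: F x + \sum_m dot w (E m x) *: E m x
      + \sum_m dot w (N m x) *: N m x.
Proof.
move=> Ux; pose w' := w - dot w (F x) *: F x - \sum_m dot w (E m x) *: E m x.
have wE : w = dot w (F x) *: F x + \sum_m dot w (E m x) *: E m x + w'.
  have -> : w' = w - (dot w (F x) *: F x + \sum_m dot w (E m x) *: E m x).
    by rewrite /w' opprD addrA.
  by rewrite [RHS]addrC subrK.
have wE' m : dot w' (E m x) = 0.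
  rewrite /w' 2!dotBl dotZl [dot (F x) _]dotC dot_EF// mulr0 subr0 dot_suml.
  rewrite (bigD1 m)//= dotZl orthonormal// eqxx mulr1 big1 ?addr0 ?subrr// => k km.
  by rewrite dotZl orthonormal// (negbTE km) mulr0.
(* The remainder is orthogonal to [F] and to every tangent vector, so the Lagrangian condition makes
   it F x (tangent vector), a combination of the [N m]. *)
have [||u w'E] := normalE (w := w') Ux.
- rewrite /w' 2!dotBl dotZl FF// mulr1 subrr sub0r dot_suml big1 ?oppr0// => m _.
  by rewrite dotZl dot_EF// mulr0.
- move=> u; rewrite (dF_decomp u Ux) dot_sumr big1// => m _.
  by rewrite dotZr wE' mulr0.
have w'N : w' = \sum_m dot (dF u x) (E m x) *: N m x.
  rewrite w'E {1}(dF_decomp u Ux) cross_sumr; apply: eq_bigr => m _.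
  by rewrite crossZr normal_cross.
rewrite {1}wE; congr (_ + _); rewrite w'N; apply: eq_bigr => m _; congr (_ *: _).
transitivity (dot w' (N m x)); first by rewrite w'E dot_FcrossN.
rewrite /w' 2!dotBl dotZl [dot (F x) _]dotC dot_NF mulr0 subr0 dot_suml big1 ?subr0//.
by move=> k _; rewrite dotZl dot_EN// mulr0.
Qed.

Lemma dot_decomp x w w' : U x -> dot w w' = dot w (F x) * dot w' (F x)
  + \sum_m dot w (E m x) * dot w' (E m x) + \sum_m dot w (N m x) * dot w' (N m x).
Proof.
move=> Ux; rewrite {1}(adapted_decomp w Ux) !dotDl dotZl !dot_suml.
rewrite [dot (F x) w']dotC.
by congr (_ + _ + _); apply: eq_bigr => m _; rewrite dotZl (dotC _ w').
Qed.

(** * Second fundamental form and connection coefficients in the frame *)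

Definition frame_h i j k x := dot (D i (E j) x) (N k x).
Definition frame_conn i j k x := dot (D i (E j) x) (E k x).
Let h := frame_h.
Let Gam := frame_conn.

Lemma smooth_dot f g : smooth_on U f -> smooth_on U g ->
  smooth_on U (fun x => dot (f x) (g x)).
Proof. exact: smooth_on_bilinear dot_bilinear. Qed.

Lemma smooth_h i j k : smooth_on U (h i j k).
Proof. apply: smooth_dot; [exact/smooth_D/smooth_frame|exact: smooth_normal]. Qed.

Lemma smooth_conn i j k : smooth_on U (Gam i j k).
Proof. apply: smooth_dot; [exact/smooth_D/smooth_frame|exact: smooth_frame]. Qed.

Lemma derive_dot f g v x : U x -> smooth_on U f -> smooth_on U g ->
  'D_v (fun y => dot (f y) (g y)) x = dot ('D_v f x) (g x) + dot (f x) ('D_v g x).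
Proof.
move=> Ux sf sg; apply: (derive_bilinear dot_bilinear);
  exact: (smooth_on_differentiable _ Ux).
Qed.

Lemma derive_dot_cst f g a v x : U x -> smooth_on U f -> smooth_on U g ->
  (forall y, U y -> dot (f y) (g y) = a) ->
  dot ('D_v f x) (g x) = - dot (f x) ('D_v g x).
Proof.
move=> Ux sf sg fg; apply/eqP; rewrite -addr_eq0 -derive_dot//.
by rewrite (@derive_eq_on R _ R U _ (cst a) v x oU fg Ux) derive_cst.
Qed.

Lemma connC i j k x : U x -> Gam i j k x = - Gam i k j x.
Proof.
move=> Ux; rewrite /Gam /frame_conn (dotC _ (E j x)) DE.
apply: (derive_dot_cst (a := (j == k)%:R) _ Ux); try exact: smooth_frame.
by move=> y Uy; rewrite orthonormal.
Qed.

Lemma D_frame i j x : U x ->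
  D i (E j) x = 'D_(e i x) ('D_(e j x) F) x + dF ('D_(e i x) (e j) x) x.
Proof.
move=> Ux; rewrite DE EE dFE; apply: (derive_derive_field oU) => //.
exact: smooth_on_differentiable (se j) Ux.
Qed.

(** The second derivative of [F] is common to both orders. What remains is tangent: invisible to
    normal vectors, and its difference is the bracket of the frame fields. *)
Lemma D_frame_symm i j x : U x -> exists a,
  D i (E j) x = a + dF ('D_(e i x) (e j) x) x /\
  D j (E i) x = a + dF ('D_(e j x) (e i) x) x.
Proof.
move=> Ux; exists ('D_(e i x) ('D_(e j x) F) x); split; first exact: D_frame.
exact: etrans (D_frame j i Ux)
  (congr1 (+%R^~ _) (esym (derive_comm (e i x) (e j x) oU sF Ux))).
Qed.

Lemma h_symm i j k x : U x -> h i j k x = h j i k x.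
Proof.
move=> Ux; rewrite /h /frame_h.
have [a [-> ->]] := D_frame_symm i j Ux.
by rewrite [LHS]dotDl [RHS]dotDl !dot_dFN.
Qed.

Lemma D_normal i j x : U x ->
  D i (N j) x = cross (E i x) (E j x) + cross (F x) (D i (E j) x).
Proof.
move=> Ux; rewrite (frame_dF i) dFE NE DE; apply: (derive_bilinear cross_bilinear).
- exact: smooth_on_differentiable sF Ux.
- exact: smooth_on_differentiable (smooth_frame j) Ux.
Qed.

(** Differentiate <E_j, N_k> = 0 along e_i and expand N_k = F x E_k by the product rule. *)
Lemma h_cross i j k x : U x ->
  h i j k x - h i k j x = dot (cross (E i x) (E j x)) (E k x).
Proof.
move=> Ux.
have : h i j k x = - dot (E j x) (D i (N k) x).
  rewrite /h /frame_h DE.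
  apply: (derive_dot_cst (a := 0)) => //; [exact: smooth_frame|exact: smooth_normal|].
  by move=> y Uy; exact: dot_EN.
move=> ->; rewrite D_normal// dotDr.
have -> : dot (E j x) (cross (F x) (D i (E k) x)) = - h i k j x.
  by rewrite dotC dot_crossC dotC -normal_cross.
have -> : dot (E j x) (cross (E i x) (E k x)) = - dot (cross (E i x) (E j x)) (E k x).
  by rewrite dotC dot_crossC.
ring.
Qed.

(** The triple product is cyclic. Adding its three expressions h_ijk - h_ikj over cyclic
    permutations, symmetry in the first two indices cancels all six terms. *)
Lemma cross_EEE i j k x : U x -> dot (cross (E i x) (E j x)) (E k x) = 0.
Proof.
move=> Ux; have := h_cross i j k Ux; have := h_cross k i j Ux.
have := h_cross j k i Ux.
rewrite -(dot_cross_cyclic (E i x)) (dot_cross_cyclic (E k x)).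
rewrite (h_symm k j i Ux) (h_symm j i k Ux) (h_symm i k j Ux).
lra.
Qed.

Lemma h_symm23 i j k x : U x -> h i j k x = h i k j x.
Proof.
by move=> Ux; apply/eqP; rewrite -subr_eq0 h_cross// cross_EEE.
Qed.


(** * Structure equations, minimality and the Codazzi equation *)

Hypothesis oriented : forall x, U x ->
  0 < dot (cross (E o0 x) (E o1 x)) (N o2 x).

Lemma cross_EEF i j x : U x -> dot (cross (E i x) (E j x)) (F x) = 0.
Proof.
by move=> Ux; rewrite -dot_cross_cyclic -normal_cross dotC dot_EN.
Qed.

(** Since [F] is orthogonal to E_j and E_k, E_j x (F x E_k) equals -F x (E_j x E_k) up to a multiple
    of [F], which is invisible to E_i. *)
Lemma cross_EEN_cyclic i j k x : U x ->
  dot (cross (E i x) (E j x)) (N k x) = dot (cross (E j x) (E k x)) (N i x).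
Proof.
move=> Ux; have FE m : dot (F x) (E m x) = 0 by rewrite dotC dot_EF.
have H : dot (cross (E j x) (N k x)) (E i x)
    = - dot (cross (F x) (cross (E j x) (E k x))) (E i x).
  apply/eqP; rewrite -addr_eq0 -dotDl normal_cross cross_cross dotBl dotDl !dotZl.
  by rewrite !FE dot_EF// !(mulr0, mul0r) subr0 addr0.
by rewrite dot_cross_cyclic H dot_crossC opprK -normal_cross dotC.
Qed.

(** The array is alternating, hence a multiple of [eps]. As E_0 x E_1 is a unit vector with only an
    N_2 component, the factor is 1 or -1; the orientation decides. *)
Lemma cross_EEN i j k x : U x ->
  dot (cross (E i x) (E j x)) (N k x) = eps i j k.
Proof.
move=> Ux; pose w i j k := dot (cross (E i x) (E j x)) (N k x).
have wN i' j' k' : w i' j' k' = - w j' i' k' by rewrite /w crossC dotNl.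
have wC i' j' k' : w i' j' k' = w j' k' i' by exact: cross_EEN_cyclic.
have wE := alternating3 wN wC.
suff w1 : w o0 o1 o2 = 1 by rewrite -[LHS]/(w i j k) wE w1 mul1r.
have := dot_decomp (cross (E o0 x) (E o1 x)) (cross (E o0 x) (E o1 x)) Ux.
rewrite dot_cross_cross !orthonormal// cross_EEF// !sum3E !cross_EEE// -!/(w _ _ _).
rewrite (wE o0 o1 o0) (wE o0 o1 o1) !epsE.
have w0 : 0 < w o0 o1 o2 := oriented Ux.
move=> H; have : w o0 o1 o2 ^+ 2 = 1 by move: H; rewrite /=; lra.
by move/eqP; rewrite sqrf_eq1 => /orP[/eqP//|/eqP wm]; move: w0; rewrite wm; lra.
Qed.

Lemma cross_EE i j x : U x -> cross (E i x) (E j x) = \sum_m eps i j m *: N m x.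
Proof.
move=> Ux; rewrite {1}(adapted_decomp (cross _ _) Ux) cross_EEF// scale0r add0r.
rewrite big1 ?add0r => [|m _]; last by rewrite cross_EEE// scale0r.
by apply: eq_bigr => m _; rewrite cross_EEN.
Qed.

Lemma dot_DNN i j k x : U x -> dot (D i (N j) x) (N k x) = eps i j k + Gam i j k x.
Proof. by move=> Ux; rewrite D_normal// dotDl cross_EEN// dot_FcrossN. Qed.

Lemma dot_DNE i j k x : U x -> dot (D i (N j) x) (E k x) = - h i k j x.
Proof.
move=> Ux; rewrite D_normal// dotDl cross_EEE// add0r dot_crossC -normal_cross.
by rewrite dotC -[dot _ _]/(h i j k x) h_symm23.
Qed.

Lemma dot_DNF i j x : U x -> dot (D i (N j) x) (F x) = 0.
Proof.
move=> Ux; rewrite D_normal// dotDl cross_EEF// add0r dot_crossC crossvv dot0l.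
by rewrite oppr0.
Qed.

Lemma dot_cross_EED i j k l x : U x ->
  dot (cross (E i x) (E j x)) (D l (E k) x) = \sum_m eps i j m * h l k m x.
Proof.
move=> Ux; rewrite cross_EE// dot_suml; apply: eq_bigr => m _.
by rewrite dotZl dotC.
Qed.

(** Differentiating <E_0 x E_1, E_2> = 0 along e_l pairs each D_l E_i with N_i, and the three terms
    are h_lii. *)
Lemma h_trace l x : U x -> \sum_i h l i i x = 0.
Proof.
move=> Ux.
have scross i j : smooth_on U (fun y => cross (E i y) (E j y)).
  by apply: (smooth_on_bilinear oU cross_bilinear); exact: smooth_frame.
have := derive_dot_cst (a := 0) (e l x) Ux (scross o0 o1) (smooth_frame o2)
  (fun y Uy => cross_EEE o0 o1 o2 Uy).
rewrite (derive_bilinear cross_bilinear); last 2 first.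
- exact: smooth_on_differentiable (smooth_frame o0) Ux.
- exact: smooth_on_differentiable (smooth_frame o1) Ux.
have DEl i : 'D_(e l x) (E i) x = D l (E i) x by rewrite DE.
rewrite !DEl => /eqP; rewrite -addr_eq0 dotDl => /eqP.
rewrite (dot_cross_cyclic (D l _ x)) -(dot_cross_cyclic (E o2 x)).
rewrite !dot_cross_EED// !sum3E !epsE; lra.
Qed.

(** Second derivatives cancel and leave the derivative along [e_i, e_j], whose frame coefficients
    are Gam_ijm - Gam_jim. *)
Lemma D_bracket i j V x : U x -> smooth_on U V ->
  D i (D j V) x - D j (D i V) x =
  \sum_m (Gam i j m x - Gam j i m x) *: D m V x.
Proof.
move=> Ux sV.
have de m : differentiable (e m) x by exact: smooth_on_differentiable (se m) Ux.
have dV : differentiable V x by exact: smooth_on_differentiable sV Ux.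
have DD k l : D k (D l V) x =
    'D_(e k x) ('D_(e l x) V) x + 'D_('D_(e k x) (e l) x) V x.
  by rewrite DE; exact: (derive_derive_field oU (e k x) Ux (de l) sV).
have DB (W : normedModType R) (f : 'rV[R]_3 -> W) u v : differentiable f x ->
    'D_u f x - 'D_v f x = 'D_(u - v) f x.
  move=> df; have := derive_linear df (- 1) v u.
  by rewrite !scaleN1r [- v + u]addrC => ->; rewrite addrC.
pose a := 'D_(e i x) (e j) x; pose b := 'D_(e j x) (e i) x.
have -> : D i (D j V) x - D j (D i V) x = 'D_a V x - 'D_b V x.
  have Hi : D i (D j V) x = 'D_(e i x) ('D_(e j x) V) x + 'D_a V x := DD i j.
  have Hj : D j (D i V) x = 'D_(e i x) ('D_(e j x) V) x + 'D_b V x.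
    exact: etrans (DD j i)
      (congr1 (+%R^~ _) (esym (derive_comm (e i x) (e j x) oU sV Ux))).
  by rewrite Hi Hj opprD addrACA subrr add0r.
have -> : 'D_a V x - 'D_b V x = 'D_(a - b) V x.
  exact: DB.
rewrite {1}(frame_decomp (a - b) Ux) derive_sumv//; apply: eq_bigr => m _.
rewrite [D m V x](_ : _ = 'D_(e m x) V x); last by rewrite DE.
congr (_ *: _); rewrite /Gam /frame_conn.
have -> : dF (a - b) x = dF a x - dF b x.
  by rewrite dFE; exact: (esym (DB _ F a b (differentiable_F Ux))).
have [d [-> ->]] := D_frame_symm i j Ux; rewrite -/a -/b; move: a b => a b.
by rewrite dotBl !(dotDl d); ring.
Qed.

Definition frame_dh l i j k x := 'D_(e l x) (h i j k) x.
Let dh := frame_dh.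

Lemma dot_DDE i j k l x : U x -> dot (D i (D j (E k)) x) (N l x) =
  dh i j k l x + \sum_m Gam j k m x * h i m l x
  - \sum_m h j k m x * (eps i l m + Gam i l m x).
Proof.
move=> Ux.
have -> : dh i j k l x = dot (D i (D j (E k)) x) (N l x)
    + dot (D j (E k) x) (D i (N l) x).
  have DEi V : D i V x = 'D_(e i x) V x by rewrite DE.
  rewrite !DEi; apply: (derive_dot _ Ux); last exact: smooth_normal.
  exact/smooth_D/smooth_frame.
rewrite (dot_decomp (D j (E k) x) (D i (N l) x) Ux) dot_DNF// mulr0 add0r.
have -> : \sum_m dot (D j (E k) x) (E m x) * dot (D i (N l) x) (E m x) =
    - \sum_m Gam j k m x * h i m l x.
  by rewrite -sumrN; apply: eq_bigr => m _; rewrite dot_DNE// mulrN.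
have -> : \sum_m dot (D j (E k) x) (N m x) * dot (D i (N l) x) (N m x) =
    \sum_m h j k m x * (eps i l m + Gam i l m x).
  by apply: eq_bigr => m _; rewrite dot_DNN.
by rewrite [- _ + _]addrC addrA addrNK addrK.
Qed.

Lemma codazzi i j k l x : U x ->
  (dh i j k l x + \sum_m Gam j k m x * h i m l x
   - \sum_m h j k m x * (eps i l m + Gam i l m x))
  - (dh j i k l x + \sum_m Gam i k m x * h j m l x
     - \sum_m h i k m x * (eps j l m + Gam j l m x))
  = \sum_m (Gam i j m x - Gam j i m x) * h m k l x.
Proof.
move=> Ux; rewrite -!dot_DDE// -dotBl D_bracket//; last exact: smooth_frame.
by rewrite dot_suml; apply: eq_bigr => m _; rewrite dotZl.
Qed.

(** * From the coordinate definitions to frame components *)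

Lemma metric_pushE X Y x : metric F X Y x = dot (dF (X x) x) (dF (Y x) x).
Proof. by rewrite dFE. Qed.

Lemma push_dF X x : push F X x = dF (X x) x.
Proof. by rewrite dFE. Qed.

Lemma derive_combination n (a : 'I_n -> 'rV[R]_3 -> R)
    (V : 'I_n -> 'rV[R]_3 -> 'rV[R]_7) v x :
  U x -> (forall m, smooth_on U (a m)) -> (forall m, smooth_on U (V m)) ->
  'D_v (fun y => \sum_m a m y *: V m y) x =
  \sum_m ('D_v (a m) x *: V m x + a m x *: 'D_v (V m) x).
Proof.
move=> Ux sa sV; have sb := @continuous_bilinear_scale R 'rV[R]_7.
have da m : differentiable (a m) x by exact: smooth_on_differentiable (sa m) Ux.
have dV m : differentiable (V m) x by exact: smooth_on_differentiable (sV m) Ux.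
rewrite derive_sum_fun; last first.
  by move=> m; exact: (differentiable_bilinear sb (da m) (dV m)).
by apply: eq_bigr => m _; exact: (derive_bilinear sb v (da m) (dV m)).
Qed.

Lemma smooth_combination n (a : 'I_n -> 'rV[R]_3 -> R)
    (V : 'I_n -> 'rV[R]_3 -> 'rV[R]_7) :
  (forall m, smooth_on U (a m)) -> (forall m, smooth_on U (V m)) ->
  smooth_on U (fun y => \sum_m a m y *: V m y).
Proof.
move=> sa sV; apply: (smooth_on_sum oU) => m.
exact: (smooth_on_bilinear oU (@continuous_bilinear_scale R 'rV[R]_7)).
Qed.

Lemma hessian_row x u v : U x ->
  'D_u ('D_v F) x = \sum_l v 0 l *: 'D_u ('D_(delta_mx 0 l) F) x.
Proof.
move=> Ux; apply: etrans (derive_comm u v oU sF Ux) _.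
have dDF : differentiable ('D_u F) x.
  exact: smooth_on_differentiable (smooth_on_derive u sF) Ux.
apply: etrans (derive_row v dDF) _; apply: eq_bigr => l _.
exact: (congr1 (fun w => v 0 l *: w) (derive_comm (delta_mx 0 l) u oU sF Ux)).
Qed.

(** In Koszul's combination of metric derivatives all second derivatives of [F] cancel except the
    (i, j) one, which occurs twice. *)
Lemma christoffelE i j x : U x -> christoffel F i j x =
  \sum_m dot ('D_(delta_mx 0 i) ('D_(delta_mx 0 j) F) x) (E m x) *: e m x.
Proof.
move=> Ux.
(* The Hessian is hidden behind a variable, so that rewriting does not unfold derivatives. *)
have [B BE] : {B : 'I_3 -> 'I_3 -> 'rV[R]_7 |
    B = fun i j => 'D_(delta_mx 0 i) ('D_(delta_mx 0 j) F) x} by eexists.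
have Bsym k l : B k l = B l k by rewrite BE; exact: derive_comm _ _ oU sF Ux.
have dm k l n : 'D_(delta_mx 0 k) (metric F (coordf l) (coordf n)) x =
    dot (B k l) (dF (delta_mx 0 n) x) + dot (dF (delta_mx 0 l) x) (B k n).
  by rewrite BE dFE; apply: (derive_dot _ Ux); exact: smooth_on_derive.
transitivity (\sum_m dot (B i j) (E m x) *: e m x); last by rewrite BE.
rewrite /christoffel raiseE//; apply: eq_bigr => m _; congr (_ *: _).
rewrite frame_dF (dF_row (e m x) Ux) dot_sumr; apply: eq_bigr => l _.
rewrite (dm i j l) (dm j i l) (dm l i j) {dm BE}.
rewrite dotZr mulrC (Bsym j i) (Bsym l i) (Bsym l j); congr (_ * _).
by rewrite (dotC (dF (delta_mx 0 j) x)) (dotC (dF (delta_mx 0 i) x)); field.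
Qed.

(** The induced connection is the tangential projection of the flat derivative: the first-order part
    is already tangent, and the Christoffel symbols project the Hessian. *)
Lemma nablaE X Y x : U x -> differentiable Y x ->
  nabla F X Y x = \sum_m dot ('D_(X x) (push F Y) x) (E m x) *: e m x.
Proof.
move=> Ux dY.
have [B BE] : {B : 'I_3 -> 'I_3 -> 'rV[R]_7 |
    B = fun i j => 'D_(delta_mx 0 i) ('D_(delta_mx 0 j) F) x} by eexists.
have H : 'D_(X x) (push F Y) x = dF ('D_(X x) Y x) x
    + \sum_i \sum_j (X x 0 i * Y x 0 j) *: B i j.
  rewrite addrC dFE; apply: etrans (derive_derive_field oU (X x) Ux dY sF) _.
  congr (_ + _).
  have dDF : differentiable ('D_(Y x) F) x.
    exact: smooth_on_differentiable (smooth_on_derive (Y x) sF) Ux.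
  apply: etrans (derive_row (X x) dDF) _; apply: eq_bigr => i _.
  rewrite (hessian_row (delta_mx 0 i) (Y x) Ux) scaler_sumr BE.
  by apply: eq_bigr => j _; rewrite scalerA.
rewrite H /nabla; move: ('D_(X x) Y x) => u.
rewrite [X in X + _](frame_decomp u Ux).
have -> : \sum_i \sum_j (X x 0 i * Y x 0 j) *: christoffel F i j x =
    \sum_m dot (\sum_i \sum_j (X x 0 i * Y x 0 j) *: B i j) (E m x) *: e m x.
  transitivity (\sum_i \sum_j \sum_m
      (X x 0 i * Y x 0 j * dot (B i j) (E m x)) *: e m x).
    apply: eq_bigr => i _; apply: eq_bigr => j _.
    rewrite christoffelE// scaler_sumr BE.
    by apply: eq_bigr => m _; rewrite scalerA.
  under eq_bigr do rewrite exchange_big.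
  rewrite exchange_big; apply: eq_bigr => m _.
  rewrite dot_suml scaler_suml; apply: eq_bigr => i _.
  rewrite dot_suml scaler_suml; apply: eq_bigr => j _.
  by rewrite dotZl.
rewrite -big_split; apply: eq_bigr => m _.
by rewrite dotDl scalerDl.
Qed.

Lemma dot_nablaS X V k x : dot (nablaS F X V x) (N k x) =
  dot ('D_(X x) V x) (N k x).
Proof.
rewrite /nablaS; move: ('D_(X x) V x) => w /=.
by rewrite dotBl dotZl (dotC (F x)) dot_NF mulr0 subr0.
Qed.

Lemma dot_sff X Y k x : U x -> dot (sff F X Y x) (N k x) =
  dot ('D_(X x) (push F Y) x) (N k x).
Proof.
move=> Ux; rewrite -dot_nablaS /sff push_dF.
by move: (nablaS _ _ _ _) => w; rewrite dotBl dot_dFN// subr0.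
Qed.

Lemma dot_nabla_perp X V k x : U x -> dot (nabla_perp F X V x) (N k x) =
  dot ('D_(X x) V x) (N k x).
Proof.
move=> Ux; rewrite -dot_nablaS /nabla_perp push_dF.
by move: (nablaS _ _ _ _) => w; rewrite dotBl dot_dFN// subr0.
Qed.

Lemma dot_sff_frame i j k x : U x -> dot (sff F (e i) (e j) x) (N k x) = h i j k x.
Proof. by move=> Ux; rewrite dot_sff// /h /frame_h DE EE. Qed.

Lemma nabla_frame i j x : U x ->
  nabla F (e i) (e j) x = \sum_m Gam i j m x *: e m x.
Proof.
move=> Ux; rewrite nablaE//; last exact: smooth_on_differentiable (se j) Ux.
by apply: eq_bigr => m _; rewrite /Gam /frame_conn DE EE.
Qed.

Lemma sff_frame i j x : U x ->
  sff F (e i) (e j) x = \sum_m h i j m x *: N m x.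
Proof.
move=> Ux.
have HS : sff F (e i) (e j) x =
    D i (E j) x - dot (D i (E j) x) (F x) *: F x - \sum_m Gam i j m x *: E m x.
  rewrite /sff push_dF nabla_frame// dF_sum// DE EE; congr (_ - _).
  by apply: eq_bigr => m _; rewrite dFE.
apply/eqP; rewrite HS !subr_eq {1}(adapted_decomp (D i (E j) x) Ux).
by apply/eqP; rewrite -addrA [RHS]addrC; congr (_ + _); rewrite addrC.
Qed.

Lemma push_nabla_frame i j x : U x ->
  push F (nabla F (e i) (e j)) x = \sum_m Gam i j m x *: E m x.
Proof.
move=> Ux; rewrite push_dF nabla_frame// dF_sum//.
by apply: eq_bigr => m _; rewrite -frame_dF.
Qed.

Lemma dot_nabla_sff l i j k x : U x ->
  dot (nabla_sff F (e l) (e i) (e j) x) (N k x) =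
  dh l i j k x + \sum_m h i j m x * (eps l m k + Gam l m k x)
  - \sum_m Gam l i m x * h m j k x - \sum_m Gam l j m x * h i m k x.
Proof.
move=> Ux; rewrite /nabla_sff dotBl dotBl; congr (_ - _ - _).
- rewrite dot_nabla_perp//.
  rewrite (derive_eq_on (g := fun y => \sum_m h i j m y *: N m y) _ oU)//; last first.
    by move=> y Uy; exact: sff_frame.
  rewrite derive_combination//; last 2 first.
  + by move=> m; exact: smooth_h.
  + exact: smooth_normal.
  have DEl m : 'D_(e l x) (N m) x = D l (N m) x by rewrite DE.
  rewrite big_split /= dotDl !dot_suml; congr (_ + _); last first.
    by apply: eq_bigr => m _; rewrite dotZl DEl dot_DNN.
  rewrite (bigD1 k)//= dotZl dot_NN// eqxx mulr1 big1 ?addr0// => m mk.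
  by rewrite dotZl dot_NN// (negbTE mk) mulr0.
- rewrite dot_sff// nabla_frame// derive_sumv; last first.
    by have := smooth_frame j; rewrite EE => /smooth_on_differentiable; exact.
  rewrite dot_suml; apply: eq_bigr => m _; rewrite dotZl.
  by rewrite /h /frame_h DE EE.
- rewrite dot_sff//.
  rewrite (derive_eq_on (g := fun y => \sum_m Gam l j m y *: E m y) _ oU)//; last first.
    by move=> y Uy; exact: push_nabla_frame.
  rewrite derive_combination//; last 2 first.
  + by move=> m; exact: smooth_conn.
  + exact: smooth_frame.
  have DEi m : 'D_(e i x) (E m) x = D i (E m) x by rewrite DE.
  rewrite dot_suml; apply: eq_bigr => m _.
  by rewrite DEi dotDl !dotZl dot_EN// mulr0 add0r.
Qed.

(** In (nabla_X J)Y the terms F x (D_X Y) cancel, and the product rule leaves X x Y. *)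
Lemma dot_G X Y k x : U x -> differentiable (push F Y) x ->
  dot (G F X Y x) (N k x) = dot (cross (dF (X x) x) (push F Y x)) (N k x).
Proof.
move=> Ux dY; rewrite /G /nablaJ dotBl dot_nablaS.
have -> : 'D_(X x) (J F (push F Y)) x =
    cross (dF (X x) x) (push F Y x) + cross (F x) ('D_(X x) (push F Y) x).
  by rewrite dFE; exact: (derive_bilinear cross_bilinear (X x) (differentiable_F Ux) dY).
rewrite /J /nablaS; move: ('D_(X x) (push F Y) x) (push F Y x) => w v /=.
by rewrite -scaleNr crossDr crossZr crossvv scaler0 addr0 dotDl addrK.
Qed.

Lemma omegac_eps i j k x : U x -> omegac F e i j k x = eps i j k.
Proof.
move=> Ux; have NEk : J F (push F (e k)) x = N k x by rewrite NE EE.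
rewrite /omegac /omega NEk dot_G//; last first.
  by have := smooth_frame j; rewrite EE => /smooth_on_differentiable; exact.
by rewrite push_dF -!frame_dF cross_EEN.
Qed.

Lemma shape_frame i k x : U x ->
  Defs.shape F (J F (push F (e k))) (e i) x = \sum_m h i m k x *: e m x.
Proof.
move=> Ux; have NEk : J F (push F (e k)) x = N k x by rewrite NE EE.
rewrite /Defs.shape raiseE//; apply: eq_bigr => m _; congr (_ *: _).
rewrite NEk /h /frame_h D_frame// [RHS]dotDl dot_dFN// addr0.
rewrite (hessian_row (e i x) (e m x) Ux) dot_suml; apply: eq_bigr => l _.
by rewrite dotZl mulrC dot_sff.
Qed.

Lemma push_shape_frame i k x : U x ->
  push F (Defs.shape F (J F (push F (e k))) (e i)) x = \sum_m h i m k x *: E m x.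
Proof.
move=> Ux; rewrite push_dF shape_frame// dF_sum//.
by apply: eq_bigr => m _; rewrite -frame_dF.
Qed.

Lemma dot_G_shape l i j k x : U x ->
  dot (G F (e l) (Defs.shape F (J F (push F (e j))) (e i)) x) (N k x) =
  \sum_m h i m j x * eps l m k.
Proof.
move=> Ux; rewrite dot_G//; last first.
  have : differentiable (fun y => \sum_m h i m j y *: E m y) x.
    apply: (smooth_on_differentiable _ Ux); apply: smooth_combination.
      by move=> m; exact: smooth_h.
    exact: smooth_frame.
  (* The pushed shape operator is differentiable because it agrees on [U] with a smooth combination
     of the [E m]. *)
  apply: near_eq_differentiable; apply: (open_near_eq oU) => // y.
  by rewrite inE => Uy; rewrite push_shape_frame.
rewrite push_shape_frame// -frame_dF cross_sumr dot_suml; apply: eq_bigr => m _.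
by rewrite crossZr dotZl cross_EEN.
Qed.

Lemma hc_frame i j k x : U x -> hc F e i j k x = h i j k x.
Proof.
move=> Ux; have NEk : J F (push F (e k)) x = N k x by rewrite NE EE.
by rewrite /hc NEk dot_sff_frame.
Qed.

Lemma Tc_frame l i j k x : U x -> Tc F e l i j k x =
  dh l i j k x + \sum_m h i j m x * (eps l m k + Gam l m k x)
  - \sum_m Gam l i m x * h m j k x - \sum_m Gam l j m x * h i m k x
  - 4^-1 * (\sum_m h i m j x * eps l m k + \sum_m h j m l x * eps i m k
            + \sum_m h l m i x * eps j m k).
Proof.
move=> Ux; have NEk : J F (push F (e k)) x = N k x by rewrite NE EE.
rewrite /Tc NEk -(dot_nabla_sff l i j k Ux) -(dot_G_shape l i j k Ux).
rewrite -(dot_G_shape i j l k Ux) -(dot_G_shape j l i k Ux) /Tfield.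
move: (nabla_sff F _ _ _ x) (G F (e l) _ x) (G F (e i) _ x) (G F (e j) _ x).
by move=> a b c d; rewrite dotBl dotZl 2!dotDl.
Qed.

Lemma sqnorm_grad_s_frame x : U x -> sqnorm_grad_s F e x =
  \sum_l (\sum_i \sum_j \sum_k 2 * (h i j k x * dh l i j k x)) ^+ 2.
Proof.
move=> Ux.
have sh2 i j k : smooth_on U (fun y => h i j k y * h i j k y).
  by apply: (smooth_on_bilinear oU continuous_bilinear_mul); exact: smooth_h.
have ss : smooth_on U (fun y => \sum_i \sum_j \sum_k h i j k y * h i j k y).
  by do 3 (apply: (smooth_on_sum oU) => ?); exact: sh2.
have sE y : U y -> \sum_i \sum_j \sum_k h i j k y * h i j k y = sqnorm_h F e y.
  move=> Uy; apply: eq_bigr => i _; apply: eq_bigr => j _; apply: eq_bigr => k _.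
  by rewrite hc_frame.
have ss' : smooth_on U (sqnorm_h F e).
  by apply: (smooth_on_eq oU _ ss) => y; rewrite inE; exact: sE.
have ds : differentiable (sqnorm_h F e) x by exact: smooth_on_differentiable ss' Ux.
have gE : gradient F (sqnorm_h F e) x =
    \sum_m 'D_(e m x) (sqnorm_h F e) x *: e m x.
  rewrite /gradient raiseE//; apply: eq_bigr => m _; congr (_ *: _).
  by rewrite (derive_row (e m x) ds); apply: eq_bigr => i _; rewrite mulrC.
have DsE v : 'D_v (sqnorm_h F e) x =
    \sum_i \sum_j \sum_k 2 * (h i j k x * 'D_v (h i j k) x).
  rewrite -(derive_eq_on v oU sE Ux).
  rewrite derive_sum_fun; last first.
    move=> i; apply: (smooth_on_differentiable _ Ux).
    by do 2 (apply: (smooth_on_sum oU) => ?); exact: sh2.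
  apply: eq_bigr => i _; rewrite derive_sum_fun; last first.
    move=> j; apply: (smooth_on_differentiable _ Ux).
    by apply: (smooth_on_sum oU) => ?; exact: sh2.
  apply: eq_bigr => j _; rewrite derive_sum_fun; last first.
    by move=> k; exact: smooth_on_differentiable (sh2 i j k) Ux.
  apply: eq_bigr => k _.
  have dhx := smooth_on_differentiable (smooth_h i j k) Ux.
  rewrite (derive_bilinear continuous_bilinear_mul v dhx dhx).
  by move: ('D_v (h i j k) x) => d; ring.
rewrite /sqnorm_grad_s metric_pushE gE dF_sum// dot_suml; apply: eq_bigr => l _.
rewrite -frame_dF dotZl dot_sumr (bigD1 l)//= big1 ?addr0 => [|m ml]; last first.
  by rewrite -frame_dF dotZr orthonormal// eq_sym (negbTE ml) mulr0.
by rewrite -frame_dF dotZr orthonormal// eqxx mulr1 DsE expr2.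
Qed.

(** * The inequality in an adapted frame *)

Lemma dh_symm12 l i j k x : U x -> dh l i j k x = dh l j i k x.
Proof.
by move=> Ux; apply: (derive_eq_on _ oU _ Ux) => y Uy; exact: h_symm.
Qed.

Lemma dh_symm23 l i j k x : U x -> dh l i j k x = dh l i k j x.
Proof.
by move=> Ux; apply: (derive_eq_on _ oU _ Ux) => y Uy; exact: h_symm23.
Qed.

Lemma dh_trace l i x : U x -> \sum_j dh l i j j x = 0.
Proof.
move=> Ux; rewrite /dh /frame_dh.
have : 'D_(e l x) (fun y => \sum_j h i j j y) x = 0.
  rewrite (@derive_eq_on R _ R U _ (cst 0) (e l x) x oU _ Ux) ?derive_cst//.
  by move=> y Uy; exact: h_trace.
rewrite derive_sum_fun// => j.
exact: smooth_on_differentiable (smooth_h i j j) Ux.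
Qed.

Lemma P_inequality x : U x ->
  9 / 40 * sqnorm_grad_s F e x - 3^-1 * sqnormA F e x <= sqnormP F e x
    + 3 * (\sum_i \sum_j \sum_k Pc F e i j k x * Pc F e j i k x).
Proof.
move=> Ux; pose hx i j k := h i j k x; pose dhx l i j k := dh l i j k x.
pose Gx i j k := Gam i j k x.
have PE i j k : Pc F e i j k x = P_components hx dhx Gx i j k.
  apply: eq_bigr => a _; apply: eq_bigr => b _.
  by rewrite hc_frame// Tc_frame.
have hx12 i j k : hx i j k = hx j i k by exact: h_symm.
have hx23 i j k : hx i j k = hx i k j by exact: h_symm23.
have hxtr i : \sum_j hx i j j = 0 by exact: h_trace.
have dhx12 l i j k : dhx l i j k = dhx l j i k by exact: dh_symm12.
have dhx23 l i j k : dhx l i j k = dhx l i k j by exact: dh_symm23.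
have dhxtr l i : \sum_j dhx l i j j = 0 by exact: dh_trace.
have GxC i j k : Gx i j k = - Gx i k j by exact: connC.
have cod i j k l := codazzi i j k l Ux.
have P23x i j k : Pc F e i j k x = Pc F e i k j x by rewrite !PE; exact: P_symm23.
have Ptrx i : \sum_j Pc F e i j j x = 0.
  by under eq_bigr do rewrite PE; exact: P_trace23.
have WE i j : Wc F e i j x = \sum_a \sum_b eps i a b * Pc F e a b j x.
  by apply: eq_bigr => a _; apply: eq_bigr => b _; rewrite omegac_eps.
have := sqnorm_traceless P23x Ptrx WE (fun i j => erefl (Ac F e i j x)).
suff -> : sqnorm_grad_s F e x = 4 * \sum_k (\sum_i Pc F e i i k x) ^+ 2.
  by rewrite /sqnormP /sqnormA mulrA (_ : 9 / 40 * 4 = 9 / 10)//; field.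
rewrite sqnorm_grad_s_frame// mulr_sumr; apply: eq_bigr => l _.
have -> : \sum_i Pc F e i i l x = \sum_i \sum_j \sum_k hx i j k * dhx l i j k.
  by under eq_bigr do rewrite PE; exact: P_trace12.
have -> : \sum_i \sum_j \sum_k 2 * (h i j k x * dh l i j k x) =
    2 * \sum_i \sum_j \sum_k hx i j k * dhx l i j k.
  rewrite mulr_sumr; apply: eq_bigr => i _; rewrite mulr_sumr.
  by apply: eq_bigr => j _; rewrite mulr_sumr.
by ring.
Qed.

End MovingFrame.

(** * From the Lagrangian immersion to the frame hypotheses *)

Theorem lemma3p2 (R : realType) (M : topologicalType)
    (hM : hausdorff_space M) (cM : @second_countable M)
    (atl : atlas3 R M) (f : M -> 'rV[R]_7) (Lf : lagrangian_immersion atl f)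
    (c : cidx atl) (U : set 'rV[R]_3) (oU : open U) (UD : U `<=` cdom c)
    (e : 'I_3 -> 'rV[R]_3 -> 'rV[R]_3)
    (he : oriented_orthonormal_frame (f \o cmap c) U e)
    (x : 'rV[R]_3) (Ux : U x) :
  let F := f \o cmap c in
  sqnormP F e x
    + 3 * (\sum_i \sum_j \sum_k Pc F e i j k x * Pc F e j i k x)
  >= 9 / 40 * sqnorm_grad_s F e x - 3^-1 * sqnormA F e x.
Proof.
pose F := f \o cmap c; have [fS imm lag] := Lf; have [se orth ori] := he.
have sF : smooth_on U F by apply: (smooth_on_subset UD); have [] := imm c.
have FF y : U y -> dot (F y) (F y) = 1 by move=> _; exact: fS.
have nE y : U y -> cross (F y) @` tangent_space F y = Defs.normal_space F y.
  by move=> Uy; exact: lag (UD y Uy).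
(* One inclusion of J(TM) = normal space gives orthogonality; the converse inclusion, in [norF],
   gives that every normal vector is F x (tangent vector). *)
have lagF y u v : U y -> dot (cross (F y) ('D_u F y)) ('D_v F y) = 0.
  move=> Uy; have : Defs.normal_space F y (cross (F y) ('D_u F y)).
    by rewrite -(nE y Uy); exists ('D_u F y) => //; exists u.
  by case=> _; apply; exists v.
have norF y w : U y -> dot w (F y) = 0 -> (forall u, dot w ('D_u F y) = 0) ->
    exists u, w = cross (F y) ('D_u F y).
  move=> Uy w0 wT; have : Defs.normal_space F y w by split=> // _ [u _ <-].
  by rewrite -(nE y Uy) => -[_ [u _ <-] <-]; exists u.
have sE i : smooth_on U (push F (e i)) by exact: smooth_on_derive_field.
have oriF y : U y -> 0 < dot (cross (push F (e o0) y) (push F (e o1) y))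
    (J F (push F (e o2)) y).
  move=> Uy; have := ori y Uy; rewrite /omega.
  have -> : (2 : 'I_3) = o2 by exact: val_inj.
  have -> : (0 : 'I_3) = o0 by exact: val_inj.
  have -> : (1 : 'I_3) = o1 by exact: val_inj.
  have dE := smooth_on_differentiable (sE o1) Uy.
  (* Positivity of [omega] concerns [G]; its N_2 component is that of E_0 x E_1, as the frame
     hypothesis requires. *)
  have GE := dot_G sF (erefl (fun u y => 'D_u F y))
    (erefl (fun i => J F (push F (e i)))) (e o0) o2 Uy dE.
  by rewrite [X in 0 < X](GE : _ = dot (cross (push F (e o0) y) _) _).
exact: (P_inequality oU sF se (erefl (fun u y => 'D_u F y))
  (erefl (fun i => push F (e i))) (erefl (fun i => J F (push F (e i))))
  (erefl (fun i V y => 'D_(e i y) V y)) FF lagF norF orth oriF Ux).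
Qed.
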